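(* Let $k\ge 1$ and let $\mu$ be a probability distribution on Boolean functions $\varphi:\{-1,+1\}^k\to\{0,1\}$ such that, for every $l\ge1$, the map $\Gamma_l$ on probability measures $\nu$ on $\{-1,1\}^l$ defined by $\Gamma_l(\nu):=\mathbb{E}_\varphi\mathbb{E}\prod_{r=1}^l(1-\varphi(Z^{(r)}))$ is convex, where $Z^{(1)},\dots,Z^{(l)}\in\{-1,1\}^k$ are such that $(Z_i^{(1)},\dots,Z_i^{(l)})$, $i=1,\dots,k$, are i.i.d. with law $\nu$, and $\varphi\sim\mu$ is independent. For $n\ge1$, $\alpha\ge0$, let $F(\alpha,n,\mu)$ be the random formula with $m=\lfloor\alpha n\rfloor$ independent clauses, clause $a$ being $\varphi_a(x_{i_1(a)},\dots,x_{i_k(a)})$ with $i_1(a),\dots,i_k(a)$ i.i.d. uniform in $\{1,\dots,n\}$ and $\varphi_a\sim\mu$; $x\in\{-1,1\}^n$ satisfies it if all clauses evaluate to $1$. Let $Z(F)$ be the number of satisfying assignments, $$\alpha^*(\mu):=\sup\{\alpha:\mathbb{P}\{Z(F(\alpha,n,\mu))=0\}=O(1/(\log n)^{1+\varepsilon})\text{ for some }\varepsilon>0\},$$ and $\psi_n(\alpha):=\frac1n\mathbb{E}[\log Z(F(\alpha,n,\mu))\mid Z(F(\alpha,n,\mu))\ge1]$. Then for every $\alpha<\alpha^*(\mu)$, $\psi_n(\alpha)$ converges as $n\to\infty$ to a limit $\phi_s(\alpha)$. *)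

(* Defs.v *)
From HB Require Import structures.
From mathcomp Require Import all_boot all_order all_algebra.
From mathcomp Require Import all_classical all_reals all_analysis.

Set Implicit Arguments.
Unset Strict Implicit.
Unset Printing Implicit Defensive.

Import Order.TTheory GRing.Theory Num.Theory.
Import numFieldNormedType.Exports.

Local Open Scope classical_set_scope.
Local Open Scope ring_scope.

(* All the random objects have finite range, so probability measures are
   represented by their mass functions. *)
Section FiniteProbability.
Context {R : realType}.
Implicit Types T I : finType.

Definition is_pmf T (p : {ffun T -> R}) : Prop :=
  (forall x, 0 <= p x) /\ \sum_x p x = 1.

Definition prob T (p : {ffun T -> R}) (A : pred T) : R := \sum_(x | A x) p x.

Definition expect T (p : {ffun T -> R}) (f : T -> R) : R :=
  \sum_x p x * f x.

(* E[f | A]; meaningful only when prob p A != 0 *)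
Definition cond_expect T (p : {ffun T -> R}) (f : T -> R) (A : pred T) : R :=
  (\sum_(x | A x) p x * f x) / prob p A.

Definition uniform_pmf T : {ffun T -> R} := [ffun=> #|T|%:R^-1].

Definition prod_pmf T1 T2 (p : {ffun T1 -> R}) (q : {ffun T2 -> R}) :
  {ffun T1 * T2 -> R} := [ffun x => p x.1 * q x.2].

Definition iid_pmf I T (p : {ffun T -> R}) : {ffun {ffun I -> T} -> R} :=
  [ffun x : {ffun I -> T} => \prod_i p (x i)].

End FiniteProbability.

(* The cube {-1,+1}^I: the boolean true stands for +1 and false for -1. *)
Definition cube (I : finType) : finType := {ffun I -> bool}.

Definition boolfun (k : nat) : finType := {ffun cube 'I_k -> bool}.

Definition clause (k n : nat) : finType := (boolfun k * {ffun 'I_k -> 'I_n})%type.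

Definition formula (k n m : nat) : finType := {ffun 'I_m -> clause k n}.

Definition clause_sat k n (x : cube 'I_n) (c : clause k n) : bool :=
  c.1 [ffun j => x (c.2 j)].

Definition satisfies k n m (x : cube 'I_n) (F : formula k n m) : bool :=
  [forall a, clause_sat x (F a)].

Definition nsat k n m (F : formula k n m) : nat :=
  #|[set x : cube 'I_n | satisfies x F]|.

Section RandomFormula.
Context {R : realType} {k : nat}.
Implicit Types (mu : {ffun boolfun k -> R}) (alpha : R).

(* In z : {ffun 'I_k -> cube 'I_l}, the entry z i is (Z_i^(1), ..., Z_i^(l)),
   so Z^(r) is the column [ffun i => z i r]. *)
Definition Gamma mu l (nu : {ffun cube 'I_l -> R}) : R :=
  expect mu (fun phi : boolfun k =>
    expect (iid_pmf 'I_k nu) (fun z : {ffun 'I_k -> cube 'I_l} =>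
      \prod_(r < l) (1 - (phi [ffun i => z i r] : nat)%:R))).

Definition Gamma_convex mu l : Prop :=
  convex_function
    ([set nu | is_pmf nu] : set (convex_lmodType {ffun cube 'I_l -> R^o}))
    (@Gamma mu l).

Definition clause_pmf mu n : {ffun clause k n -> R} :=
  prod_pmf mu (iid_pmf 'I_k (uniform_pmf 'I_n)).

(* Num.truncn is the integer part, for alpha >= 0 *)
Definition nclauses alpha n : nat := Num.truncn (alpha * n%:R).

Definition formula_pmf mu alpha n :
    {ffun formula k n (nclauses alpha n) -> R} :=
  iid_pmf 'I_(nclauses alpha n) (clause_pmf mu n).

Definition prob_unsat mu alpha n : R :=
  prob (formula_pmf mu alpha n) (fun F => nsat F == 0)%N.

Definition psi mu alpha n : R :=
  n%:R^-1 * cond_expect (formula_pmf mu alpha n)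
    (fun F => ln (nsat F)%:R) (fun F => 1 <= nsat F)%N.

Definition polylog_decay (u : nat -> R) : Prop :=
  exists2 eps : R, 0 < eps &
    (u : nat -> R^o) =O_\oo (fun n => (ln n%:R `^ (1 + eps))^-1 : R^o).

(* The supremum is taken in the extended reals, as it may be infinite. *)
Definition alpha_star mu : \bar R :=
  ereal_sup [set alpha%:E | alpha in
    [set alpha : R | 0 <= alpha /\ polylog_decay (prob_unsat mu alpha)]].

End RandomFormula.

(* Main.v *)
(* Interpolation in the number of variables. For a finite system of clauses
   with Z solutions, adding one clause to an instance on n1 + n2 variables
   multiplies 1 + Z by 1 - theta, and - ln (1 - theta) = sum_l theta^l / l; the
   convexity of every Gamma_l then says that a clause on all the variables costs
   less, on average, than a clause that falls in the i-th block with probability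
   ni / (n1 + n2). Using ln (1 + Z) instead of ln Z keeps unsatisfiable instances
   harmless here. They only enter when ln (1 + Z1 Z2) is compared with
   ln (1 + Z1) + ln (1 + Z2), with an error n * P(unsat), and P(unsat) =
   O((ln n)^-(1 + eps)) is exactly what makes these errors summable along a
   dyadic splitting of n into blocks of a fixed size n0.

   This bounds E ln (1 + Z_N) / N from below by the average of
   E ln (1 + Z_n0) / n0 over a binomial number of clauses of mean alpha n0,
   almost a Poisson number. With phi the limsup over n0 of the latter averages,
   liminf E ln (1 + Z_N) / N >= phi, and phi is almost not decreased when alpha
   grows slightly. Since E ln (1 + Z) decreases with the number of clauses and a
   binomial variable is below its mean with probability at least 1/16, a value of
   E ln (1 + Z_n0) / n0 at alpha n0 clauses well above phi would push the average
   above phi as well: hence limsup <= phi, and this for every alpha, with no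
   exceptional set. *)

Require Import Defs.
From HB Require Import structures.
From mathcomp Require Import all_boot all_order all_algebra.
From mathcomp Require Import all_classical all_reals all_analysis.
From mathcomp Require Import ring lra zify.

Set Implicit Arguments.
Unset Strict Implicit.
Unset Printing Implicit Defensive.

Import Order.TTheory GRing.Theory Num.Theory.
Import numFieldNormedType.Exports.

Local Open Scope classical_set_scope.
Local Open Scope ring_scope.

(** * Binomial averages *)

Section Binomial.
Context {R : realFieldType}.
Implicit Types (p q : R) (m j : nat) (f g : nat -> R).

(** The mean of [f] at a binomial variable with [m] trials of parameter [p], written by conditioning
    on one trial so that inductions on the number of clauses follow the same recursion. *)
Fixpoint binE p m f : R :=
  if m is m'.+1 then p * binE p m' (fun j => f j.+1) + (1 - p) * binE p m' f
  else f 0%N.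

Lemma eq_binE p m f g : f =1 g -> binE p m f = binE p m g.
Proof.
by elim: m f g => [|m IH] f g fg //=; congr (_ * _ + _ * _); apply: IH => j.
Qed.

Lemma ler_binE p m f g : 0 <= p <= 1 -> (forall j, f j <= g j) ->
  binE p m f <= binE p m g.
Proof.
move=> /andP[p0 p1]; elim: m f g => [|m IH] f g fg //=.
by rewrite lerD// ler_wpM2l ?subr_ge0// IH.
Qed.

Lemma binE_cst p m c : binE p m (fun=> c) = c.
Proof. by elim: m => //= m ->; ring. Qed.

Lemma binED p m f g :
  binE p m (fun j => f j + g j) = binE p m f + binE p m g.
Proof. by elim: m f g => //= m IH f g; rewrite !IH; ring. Qed.

Lemma binEZ p m c f : binE p m (fun j => c * f j) = c * binE p m f.
Proof. by elim: m f => //= m IH f; rewrite !IH; ring. Qed.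

Lemma binE1 m f : binE 1 m f = f m.
Proof. by elim: m f => //= m IH f; rewrite IH; ring. Qed.

(** Thinning of a binomial variable; it lets the splittings of a block be nested. *)
Lemma binE_thin p q m f :
  binE p m (fun j => binE q j f) = binE (p * q) m f.
Proof.
elim: m f => //= m IH f.
by rewrite binED !binEZ !IH; ring.
Qed.

(** Each of the [d] extra trials succeeds with probability [p], and a success lowers [f] by at most
    [b]. *)
Lemma binE_lipschitz p m d f (b : R) : 0 <= p <= 1 ->
  (forall j, f j - b <= f j.+1) ->
  binE p m f - d%:R * (p * b) <= binE p (m + d) f.
Proof.
move=> /andP[p0 p1] fb; elim: d => [|d IH]; first by rewrite addn0; lra.
rewrite addnS /=; set B := binE p (m + d) f in IH *.
have : B - b <= binE p (m + d) (fun j => f j.+1).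
  have -> : B - b = binE p (m + d) (fun j => f j + - b) by rewrite binED binE_cst.
  by apply: ler_binE => //; apply/andP.
rewrite -natr1; nra.
Qed.

Definition cpow p m i j : R := (j%:R - p * m%:R) ^+ i.

Lemma binE_cpowS p m i : binE p m.+1 (cpow p m.+1 i) =
  binE p m (fun j => p * (cpow p m 1 j + (1 - p)) ^+ i
                     + (1 - p) * (cpow p m 1 j - p) ^+ i).
Proof.
rewrite /= binED !binEZ; congr (_ * _ + _ * _); apply: eq_binE => j;
by rewrite /cpow expr1 -!natr1; congr (_ ^+ _); ring.
Qed.

Lemma binE_cpow1 p m : binE p m (cpow p m 1) = 0.
Proof.
elim: m => [|m IH]; first by rewrite /= /cpow !mulr0n !mulr0 subrr expr0n.
rewrite binE_cpowS -[RHS]IH; apply: eq_binE => j; ring.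
Qed.

Lemma binE_cpow2 p m : binE p m (cpow p m 2) = m%:R * (p * (1 - p)).
Proof.
elim: m => [|m IH]; first by rewrite /= /cpow !mulr0n !mulr0 subrr expr0n mul0r.
rewrite binE_cpowS -natr1 mulrDl -IH mul1r.
rewrite -[X in _ = _ + X](binE_cst p m) -binED; apply: eq_binE => j.
by rewrite /cpow; ring.
Qed.

Lemma binE_cpow4 p m : 0 <= p <= 1 ->
  binE p m (cpow p m 4) <=
  3%:R * (m%:R * (p * (1 - p))) ^+ 2 + m%:R * (p * (1 - p)).
Proof.
move=> /andP[p0 p1]; elim: m => [|m IH].
  by rewrite /= /cpow !mulr0n !mulr0 subrr !mul0r !expr0n /= mulr0 addr0.
set v := p * (1 - p) in IH *.
(* The third moment drops out because its coefficient is the mean of a centred trial; the factor 0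
   stands for the first moment. *)
have -> : binE p m.+1 (cpow p m.+1 4) =
    binE p m (cpow p m 4) + 6%:R * v * (m%:R * v)
    + 4%:R * (v * (1 - p - p)) * 0 + v * (p ^+ 3 + (1 - p) ^+ 3).
  rewrite binE_cpowS -(binE_cpow2 p m) -(binE_cpow1 p m).
  rewrite -[X in _ = _ + X](binE_cst p m) -!binEZ -!binED.
  by apply: eq_binE => j; rewrite /cpow /v; ring.
rewrite -[m.+1%:R]natr1 mulr0 addr0.
have v0 : 0 <= v by rewrite mulr_ge0// subr_ge0.
have p3 : v * (p ^+ 3 + (1 - p) ^+ 3) <= v.
  rewrite -[leRHS]mulr1 ler_wpM2l//.
  have -> : p ^+ 3 + (1 - p) ^+ 3 = 1 - 3%:R * v by rewrite /v; ring.
  lra.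
have -> : 3%:R * ((m%:R + 1) * v) ^+ 2 + (m%:R + 1) * v =
  3%:R * (m%:R * v) ^+ 2 + m%:R * v + 6%:R * v * (m%:R * v)
  + (3%:R * v ^+ 2 + v) by ring.
have := sqr_ge0 v; lra.
Qed.

Lemma binE_chebyshev p m (t : R) : 0 <= p <= 1 -> p * m%:R < t ->
  binE p m (fun j => (t < j%:R)%R%:R) <= p * m%:R / (t - p * m%:R) ^+ 2.
Proof.
move=> p01 tp; have t0 : 0 < t - p * m%:R by rewrite subr_gt0.
have -> : p * m%:R / (t - p * m%:R) ^+ 2 =
  ((t - p * m%:R) ^+ 2)^-1 * (m%:R * (p * (1 - p)))
  + ((t - p * m%:R) ^+ 2)^-1 * (m%:R * p ^+ 2) by ring.
rewrite -binE_cpow2 -binEZ ler_wpDr//.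
  by rewrite mulr_ge0 ?invr_ge0 ?sqr_ge0// mulr_ge0// sqr_ge0.
apply: ler_binE => // j; case: (ltP t j%:R) => [tj|_]; last first.
  by rewrite mulr_ge0// ?invr_ge0 sqr_ge0.
rewrite mulrC ler_pdivlMr ?exprn_gt0// mul1r /cpow ler_sqr ?nnegrE; lra.
Qed.

(* Paley-Zygmund in polynomial form: with y the centred variable and s its
   variance, 1_{y <= 0} >= (- 5 y / sqrt s + 5 y^2 / s - y^4 / s^2) / 16, where
   the linear term, of mean 0, is written with t = sqrt s. *)
Lemma binE_le_mean p m (t : R) : 0 <= p <= 1 -> 0 < t ->
  t ^+ 2 = m%:R * (p * (1 - p)) -> 1 <= t ->
  16%:R^-1 <= binE p m (fun j => (j%:R <= p * m%:R)%R%:R).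
Proof.
move=> p01 t0 ts t1.
pose Q j := 16%:R^-1 * (- 5%:R / t * cpow p m 1 j + 5%:R / t ^+ 2 * cpow p m 2 j
   + - (t ^+ 4)^-1 * cpow p m 4 j).
have : binE p m Q <= binE p m (fun j => (j%:R <= p * m%:R)%R%:R).
  apply: ler_binE => // j; rewrite /Q.
  pose z := cpow p m 1 j / t.
  have -> : - 5%:R / t * cpow p m 1 j + 5%:R / t ^+ 2 * cpow p m 2 j
   + - (t ^+ 4)^-1 * cpow p m 4 j = - 5%:R * z + 5%:R * z ^+ 2 - z ^+ 4.
    by rewrite /z /cpow; field; rewrite gt_eqF.
  have zj : (j%:R <= p * m%:R) = (z <= 0).
    by rewrite /z /cpow expr1 pmulr_lle0 ?invr_gt0// subr_le0.
  rewrite zj; case: (ltP 0 z) => z0 /=.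
    suff : z * (5%:R - 5%:R * z + z ^+ 3) >= 0 by lra.
    apply: mulr_ge0; [lra|].
    (* 4/3 is close to the minimiser sqrt (5/3) of z^3 - 5 z; the product equals z^3 - 16 z / 3 +
       128 / 27, which is below z^3 - 5 z + 5 for z >= 0. *)
    have : 0 <= (z - 4%:R / 3%:R) ^+ 2 * (z + 8%:R / 3%:R).
      by rewrite mulr_ge0 ?sqr_ge0//; lra.
    lra.
  (* The two squares add up to z^4 - 5 z^2 + 5 z + 61/4, and 61/4 < 16. *)
  have := sqr_ge0 (z ^+ 2 - 3%:R); have := sqr_ge0 (z + 5%:R / 2%:R); lra.
apply: le_trans; rewrite /Q binEZ !binED !binEZ binE_cpow1 binE_cpow2 -ts.
have := binE_cpow4 m p01; rewrite -ts => m4.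
have t2 : 1 <= t ^+ 2 by rewrite exprn_ege1.
(* As t >= 1, the fourth moment is at most 3 t^4 + t^2 <= 4 t^4, so [Q] has mean at least (5 - 4) /
   16. *)
have : (t ^+ 4)^-1 * binE p m (cpow p m 4) <= 4%:R.
  rewrite mulrC ler_pdivrMr ?exprn_gt0//; apply: le_trans m4 _.
  by rewrite (_ : t ^+ 4 = (t ^+ 2) ^+ 2) -?exprM//; nra.
rewrite mulr0 add0r mulfVK ?gt_eqF ?exprn_gt0//; lra.
Qed.

End Binomial.

(** * The interpolation inequality *)

Section LogSeries.
Context {R : realType}.

Let psum L (x : R) : R := \sum_(l < L) l.+1%:R^-1 * x ^+ l.+1.

Let dpsum L (x : R) : is_derive x 1 (psum L) (\sum_(l < L) x ^+ l).
Proof.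
elim: L => [|L IH].
  have -> : psum 0 = cst 0 by apply/funext => y; rewrite /psum big_ord0.
  by rewrite big_ord0; exact: is_derive_cst.
have -> : psum L.+1 = psum L + (L.+1%:R^-1 \*: (id ^+ L.+1)).
  apply/funext => y; rewrite /psum big_ord_recr /= fctE /=; congr (_ + _).
  by rewrite /GRing.scale /= fctE.
rewrite big_ord_recr /=; apply: is_deriveD.
have -> : x ^+ L = L.+1%:R^-1 *: ((L.+1%:R * x ^+ L.+1.-1) *: (1 : R)).
  by rewrite /GRing.scale /= mulr1 mulKf// pnatr_eq0.
by apply: is_deriveZ; apply: is_deriveX.
Qed.

(** The remainder of the series has derivative y^L / (1 - y), which is nonnegative and increasing;
    the mean value theorem on [0, x] then gives both bounds. *)
Lemma ln_series L (x : R) : 0 <= x < 1 ->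
  \sum_(l < L) l.+1%:R^-1 * x ^+ l.+1 <= - ln (1 - x) <=
  \sum_(l < L) l.+1%:R^-1 * x ^+ l.+1 + x ^+ L / (1 - x).
Proof.
rewrite -/(psum L x) => /andP[x0 x1].
have x10 : 0 < 1 - x by rewrite subr_gt0.
have [->|xn0] := eqVneq x 0.
  rewrite subr0 ln1 oppr0 /psum big1 ?add0r ?lexx ?divr1 ?exprn_ge0//.
  by move=> i _; rewrite expr0n mulr0.
have xp : 0 < x by rewrite lt_neqAle eq_sym xn0.
pose h (y : R) := - ln (1 - y) - psum L y.
pose dh (y : R) := (1 - y)^-1 - \sum_(l < L) y ^+ l.
have hd (y : R) : y < 1 -> is_derive y 1 h (dh y).
  move=> y1; have -> : h = - (@ln R \o (cst 1 - id)) - psum L.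
    by apply/funext => z; rewrite /h !fctE.
  rewrite /dh; apply: is_deriveB; last exact: dpsum.
  have -> : (1 - y)^-1 = - ((1 - y)^-1 * (-1)) by rewrite mulrN1 opprK.
  apply: is_deriveN; apply: is_derive1_comp.
    by apply: is_derive1_ln; rewrite subr_gt0.
  rewrite -[X in is_derive _ _ _ X](add0r (-1)); exact: is_deriveB.
have [||c] := @MVT R h dh 0 x xp.
- by move=> y; rewrite in_itv /= => /andP[_ yx]; apply: hd; exact: lt_trans x1.
- apply: derivable_within_continuous => y; rewrite in_itv /= => /andP[_ yx].
  by have [] := hd y (le_lt_trans yx x1).
move=> /itvP cx.
have c0 : 0 <= c by rewrite cx.
have cx' : c <= x by rewrite cx.
have c1 : 0 < 1 - c by lra.
have -> : h 0 = 0.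
  rewrite /h subr0 ln1 oppr0 sub0r /psum big1 ?oppr0// => i _.
  by rewrite expr0n mulr0.
have -> : dh c = c ^+ L / (1 - c).
  apply: (mulIf (lt0r_neq0 c1)); rewrite /dh mulrBl mulVf ?divfK ?lt0r_neq0//.
  by have := subrX1 c L; lra.
rewrite !subr0 => hx.
have hx' : - ln (1 - x) = psum L x + c ^+ L / (1 - c) * x by rewrite -hx /h; ring.
rewrite hx' lerDl lerD2l; apply/andP; split.
  by rewrite mulr_ge0// mulr_ge0 ?exprn_ge0// invr_ge0 ltW.
rewrite -[leRHS]mulr1; apply: ler_pM => //.
- by rewrite mulr_ge0 ?exprn_ge0// invr_ge0 ltW.
- apply: ler_pM; rewrite ?exprn_ge0 ?invr_ge0 ?(ltW c1)//.
    by apply: lerXn2r; rewrite ?nnegrE.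
  by rewrite lef_pV2 ?posrE//; lra.
- exact: ltW.
Qed.

End LogSeries.

(** * Moments of the proportion of solutions killed by one random clause *)

Section Interpolation.
Context {R : realType} {k : nat} (mu : {ffun boolfun k -> R}).
Hypothesis hmu : is_pmf mu.

Definition sats s n (e : 'I_s -> 'I_n) (c : clause k s) : {set cube 'I_n} :=
  [set x : cube 'I_n | c.1 [ffun j => x (e (c.2 j))]]%SET.

(* The formulas enter only through their sets S of solutions; step averages f
   over the addition of one random clause on the variables in the image of e. *)
Definition step s n (e : 'I_s -> 'I_n) (f : {set cube 'I_n} -> R)
    (S : {set cube 'I_n}) : R :=
  \sum_c clause_pmf mu s c * f (S :&: sats e c).

Lemma clause_pmf_ge0 s c : 0 <= clause_pmf mu s c.
Proof.
rewrite !ffunE mulr_ge0//; first by case: hmu.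
by rewrite prodr_ge0// => i _; rewrite ffunE invr_ge0.
Qed.

Lemma sum_clause_pmf s : (0 < s)%N -> \sum_c clause_pmf mu s c = 1.
Proof.
move=> s0; under eq_bigr do rewrite !ffunE.
rewrite -(pair_bigA _ (fun a (b : {ffun 'I_k -> 'I_s}) => mu a * \prod_i uniform_pmf 'I_s (b i))) /=.
under eq_bigr do rewrite -mulr_sumr -(bigA_distr_bigA (fun _ j => uniform_pmf 'I_s j)) /=.
rewrite -mulr_suml; case: hmu => _ ->; rewrite mul1r big1// => i _.
under eq_bigr do rewrite ffunE.
by rewrite sumr_const !card_ord -[LHS]mulr_natr mulVf// pnatr_eq0 -lt0n.
Qed.

Lemma ler_step s n (e : 'I_s -> 'I_n) f g S :
  (forall S', f S' <= g S') -> step e f S <= step e g S.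
Proof. by move=> fg; apply: ler_sum => c _; rewrite ler_wpM2l ?clause_pmf_ge0. Qed.

Lemma step_cst s n (e : 'I_s -> 'I_n) (a : R) S : (0 < s)%N ->
  step e (fun=> a) S = a.
Proof. by move=> s0; rewrite /step -mulr_suml sum_clause_pmf// mul1r. Qed.

Lemma stepC s n (e : 'I_s -> 'I_n) s' (e' : 'I_s' -> 'I_n) f S :
  step e (step e' f) S = step e' (step e f) S.
Proof.
rewrite /step; under eq_bigr do rewrite mulr_sumr.
rewrite exchange_big /=; apply: eq_bigr => c _; rewrite mulr_sumr.
by apply: eq_bigr => c' _; rewrite mulrCA finset.setIAC.
Qed.

Lemma stepD s n (e : 'I_s -> 'I_n) (a b : R) f g S :
  step e (fun S => a * f S + b * g S) S = a * step e f S + b * step e g S.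
Proof.
rewrite /step !mulr_sumr -big_split; apply: eq_bigr => c _ /=; ring.
Qed.

(* The law of (x_i^(1), ..., x_i^(l)) for i uniform in the image of e. *)
Definition emp_pmf s n (e : 'I_s -> 'I_n) l (xs : {ffun 'I_l -> cube 'I_n}) :
    {ffun cube 'I_l -> R} :=
  [ffun v => \sum_(i | [ffun r => xs r (e i)] == v) s%:R^-1].

Lemma emp_pmfP s n (e : 'I_s -> 'I_n) l (xs : {ffun 'I_l -> cube 'I_n}) :
  (0 < s)%N -> is_pmf (emp_pmf e xs).
Proof.
move=> s0; split=> [v|].
  by rewrite ffunE sumr_ge0// => i _; rewrite invr_ge0.
under eq_bigr do rewrite ffunE.
transitivity (\sum_(i < s) s%:R^-1 : R).
  by rewrite [RHS](partition_big (fun i => [ffun r => xs r (e i)]) xpredT).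
by rewrite sumr_const !card_ord -[LHS]mulr_natr mulVf// pnatr_eq0 -lt0n.
Qed.

(** Pushforward of a product weight, grouped by fibres of [h]: images of independent coordinates
    stay independent. *)
Lemma sum_ffun_map (A B : finType) (w : A -> R) (h : A -> B)
    (G : {ffun 'I_k -> B} -> R) :
  \sum_(a : {ffun 'I_k -> A}) (\prod_i w (a i)) * G [ffun i => h (a i)] =
  \sum_(z : {ffun 'I_k -> B}) (\prod_i \sum_(a | h a == z i) w a) * G z.
Proof.
rewrite (partition_big (fun a : {ffun 'I_k -> A} => [ffun i => h (a i)]) xpredT)//=.
apply: eq_bigr => z _.
rewrite (bigA_distr_big_dep (fun i => [pred a | h a == z i])) mulr_suml /=.
apply: eq_big => [a|a /eqP ->//].
apply/eqP/familyP => [az i|az]; first by rewrite inE -az ffunE.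
by apply/ffunP => i; rewrite ffunE; apply/eqP; apply: az.
Qed.

(** The l-th power counts the l-tuples of solutions that the clause kills together. For a fixed
    tuple, the values at the k random variables of the clause are i.i.d. with the empirical law of
    the tuple, which is the average that [Gamma] takes. *)
Lemma step_moment s n (e : 'I_s -> 'I_n) l (S : {set cube 'I_n}) :
  \sum_c clause_pmf mu s c * #|S :\: sats e c|%:R ^+ l =
  \sum_(xs in ffun_on S) Gamma mu (@emp_pmf s n e l xs).
Proof.
have cardE c : #|S :\: sats e c|%:R ^+ l =
    \sum_(xs in ffun_on S) \prod_(r < l)
      (1 - (c.1 [ffun j => xs r (e (c.2 j))] : nat)%:R) :> R.
  have -> : #|S :\: sats e c|%:R =
      \sum_(x in S) (1 - (c.1 [ffun j => x (e (c.2 j))] : nat)%:R) :> R.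
    rewrite -sum1_card natr_sum [RHS](big_setID (sats e c)) /= [X in _ = X + _]big1 ?add0r.
      by apply: eq_bigr => x; rewrite !inE => /andP[/negbTE -> _]; rewrite subr0.
    by move=> x; rewrite !inE => /andP[_ ->]; rewrite subrr.
  rewrite -[l in LHS]card_ord -prodr_const.
  by rewrite (bigA_distr_big (mem S) (fun _ (x : cube 'I_n) => _)).
under eq_bigr do rewrite cardE mulr_sumr.
rewrite exchange_big /=; apply: eq_bigr => xs _.
under eq_bigr do rewrite !ffunE.
pose G (a : boolfun k) (b : {ffun 'I_k -> 'I_s}) : R :=
  mu a * \prod_i uniform_pmf 'I_s (b i) *
  \prod_(r < l) (1 - (a [ffun j => xs r (e (b j))] : nat)%:R).
rewrite -(pair_bigA _ G) /= /Gamma /expect; apply: eq_bigr => a _.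
rewrite /G; under eq_bigr do rewrite -mulrA.
rewrite -mulr_sumr; congr (_ * _).
pose H (z : {ffun 'I_k -> cube 'I_l}) : R :=
  \prod_(r < l) (1 - (a [ffun i => z i r] : nat)%:R).
transitivity (\sum_(b : {ffun 'I_k -> 'I_s}) (\prod_i (fun=> s%:R^-1) (b i)) *
   H [ffun i => (fun b => [ffun r => xs r (e b)]) (b i)]).
  apply: eq_bigr => b _; congr (_ * _).
    by apply: eq_bigr => i _; rewrite ffunE card_ord.
  apply: eq_bigr => r _; congr (1 - (a _ : nat)%:R).
  by apply/ffunP => j; rewrite !ffunE.
rewrite (sum_ffun_map (fun=> _) (fun b => [ffun r => xs r (e b)]) H).
apply: eq_bigr => z _; rewrite ffunE; congr (_ * _).
by apply: eq_bigr => i _; rewrite ffunE.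
Qed.

End Interpolation.

Section OneStep.
Context {R : realType} {k : nat} (mu : {ffun boolfun k -> R}).
Hypothesis hmu : is_pmf mu.
Hypothesis hGamma : forall l : nat, (1 <= l)%N -> Gamma_convex mu l.

(** The empirical law over all variables is the mixture of those over the two blocks, weighted by
    their sizes. *)
Lemma Gamma_emp_split n1 n2 l (xs : {ffun 'I_l -> cube 'I_(n1 + n2)}) :
  (0 < n1)%N -> (0 < n2)%N -> (0 < l)%N ->
  Gamma mu (emp_pmf (R := R) id xs) <=
  n1%:R / (n1 + n2)%:R * Gamma mu (emp_pmf (lshift n2) xs) +
  n2%:R / (n1 + n2)%:R * Gamma mu (emp_pmf (@rshift n1 n2) xs).
Proof.
move=> n1p n2p lp.
have np : 0 < (n1 + n2)%:R :> R by rewrite ltr0n addn_gt0 n1p.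
have t0 : 0 <= n1%:R / (n1 + n2)%:R :> R by rewrite divr_ge0.
have t1 : n1%:R / (n1 + n2)%:R <= 1 :> R.
  by rewrite ler_pdivrMr// mul1r ler_nat leq_addr.
have t2 : 1 - n1%:R / (n1 + n2)%:R = n2%:R / (n1 + n2)%:R :> R.
  rewrite -[X in X - _](@divff _ (n1 + n2)%:R) ?gt_eqF//.
  by rewrite -mulrBl natrD addrAC subrr add0r.
have := @hGamma l lp (Itv01 t0 t1) (emp_pmf (lshift n2) xs)
  (emp_pmf (@rshift n1 n2) xs).
rewrite !inE /= => /(_ (emp_pmfP _ _ n1p) (emp_pmfP _ _ n2p)).
rewrite convRE /= /unstable.onem t2; apply: le_trans.
rewrite le_eqVlt; apply/orP; left; apply/eqP; congr (Gamma mu _).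
apply/ffunP => v; rewrite /conv /= /unstable.onem t2 !ffunE big_split_ord /=.
rewrite /GRing.scale /= !mulr_sumr.
congr (_ + _); apply: eq_bigr => i _.
  by rewrite mulrAC divff ?mul1r// pnatr_eq0 -lt0n.
by rewrite mulrAC divff ?mul1r// pnatr_eq0 -lt0n.
Qed.

Definition lnp1 n (S : {set cube 'I_n}) : R := ln (1 + #|S|%:R).

(** The series of - ln (1 - theta) has positive coefficients, so [Gamma_emp_split] compares the two
    sides moment by moment; the truncation order L is sent to infinity at the end. *)
Lemma step_lnp1 n1 n2 (S : {set cube 'I_(n1 + n2)}) :
  (0 < n1)%N -> (0 < n2)%N ->
  n1%:R / (n1 + n2)%:R * step mu (lshift n2) (@lnp1 _) S +
  n2%:R / (n1 + n2)%:R * step mu (@rshift n1 n2) (@lnp1 _) S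
  <= step mu id (@lnp1 _) S.
Proof.
move=> n1p n2p; set p1 := n1%:R / _; set p2 := n2%:R / _.
have np : (0 < n1 + n2)%N by rewrite addn_gt0 n1p.
have p1_ge0 : 0 <= p1 by rewrite divr_ge0.
have p2_ge0 : 0 <= p2 by rewrite divr_ge0.
have p12 : p1 + p2 = 1 by rewrite -mulrDl -natrD divff// pnatr_eq0 -lt0n.
set W : R := 1 + #|S|%:R.
have W0 : 0 < W by rewrite ltr_wpDr.
(* A bound on theta common to all clauses. The 1 in [W] keeps it below 1 even if a clause kills
   every solution, so a single tail b^L / (1 - b) serves everywhere. *)
pose b : R := #|S|%:R / W.
have b01 : 0 <= b < 1.
  by rewrite divr_ge0 ?(ltW W0)//= ltr_pdivrMr// mul1r ltrDr.
have b1 : 0 < 1 - b by rewrite subr_gt0; case/andP: b01.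
pose th s (e : 'I_s -> 'I_(n1 + n2)) (c : clause k s) : R := #|S :\: sats e c|%:R / W.
have th_b s (e : 'I_s -> 'I_(n1 + n2)) c : 0 <= th s e c <= b.
  rewrite divr_ge0 ?(ltW W0)//= ler_pM2r ?invr_gt0// ler_nat.
  by rewrite subset_leq_card// finset.subsetDl.
have lnE s (e : 'I_s -> 'I_(n1 + n2)) c :
    lnp1 (S :&: sats e c) = ln W + ln (1 - th s e c).
  have /andP[_ h] := th_b s e c.
  rewrite -lnM ?posrE//; last lra.
  congr ln; rewrite mulrBr mulr1 mulrC divfK ?gt_eqF// /W.
  by rewrite -(cardsID (sats e c) S) natrD; ring.
pose Q L s (e : 'I_s -> 'I_(n1 + n2)) : R :=
  \sum_(l < L) l.+1%:R^-1 * (W^-1 ^+ l.+1 *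
    \sum_c clause_pmf mu s c * #|S :\: sats e c|%:R ^+ l.+1).
have QE L s (e : 'I_s -> 'I_(n1 + n2)) :
    Q L s e = \sum_c clause_pmf mu s c *
      \sum_(l < L) l.+1%:R^-1 * th s e c ^+ l.+1.
  rewrite /Q; under [RHS]eq_bigr do rewrite mulr_sumr.
  rewrite [RHS]exchange_big /=; apply: eq_bigr => l _; rewrite !mulr_sumr.
  by apply: eq_bigr => c _; rewrite /th exprMn; ring.
(* Block clauses are bounded above, where truncating the series costs nothing; only the clause on
   all variables, bounded below, pays for the tail. *)
have up L s (e : 'I_s -> 'I_(n1 + n2)) : (0 < s)%N ->
    step mu e (@lnp1 _) S <= ln W - Q L s e.
  move=> s0; rewrite -(step_cst hmu e (ln W) S s0) QE -sumrB.
  apply: ler_sum => c _; rewrite -mulrBr ler_wpM2l ?clause_pmf_ge0// lnE.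
  have /andP[h0 hb] := th_b s e c; have /andP[_ b1'] := b01.
  have th1 : 0 <= th s e c < 1 by rewrite h0 (le_lt_trans hb).
  have /andP[] := ln_series L th1; lra.
have lo L : ln W - Q L _ id - b ^+ L / (1 - b) <= step mu id (@lnp1 _) S.
  rewrite addrAC -(step_cst hmu id (ln W - b ^+ L / (1 - b)) S np) QE -sumrB.
  apply: ler_sum => c _; rewrite -mulrBr ler_wpM2l ?clause_pmf_ge0// lnE.
  have /andP[h0 hb] := th_b _ id c; have /andP[b0 b1'] := b01.
  have th1 : 0 <= th _ id c < 1 by rewrite h0 (le_lt_trans hb).
  have /andP[_] := ln_series L th1.
  suff : th _ id c ^+ L / (1 - th _ id c) <= b ^+ L / (1 - b) by lra.
  apply: ler_pM; rewrite ?exprn_ge0 ?invr_ge0//; [lra| |].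
    by apply: lerXn2r; rewrite ?nnegrE.
  by rewrite lef_pV2 ?posrE//; lra.
have QQ L : Q L _ id <= p1 * Q L _ (lshift n2) + p2 * Q L _ (@rshift n1 n2).
  rewrite /Q !mulr_sumr -big_split /=; apply: ler_sum => l _.
  rewrite !(mulrCA _ (l.+1%:R^-1)) -mulrDr ler_wpM2l ?invr_ge0//.
  rewrite !(mulrCA _ (W^-1 ^+ _)) -mulrDr ler_wpM2l ?exprn_ge0 ?invr_ge0 ?(ltW W0)//.
  rewrite !step_moment !mulr_sumr -big_split /=; apply: ler_sum => xs _.
  exact: Gamma_emp_split.
apply/ler_addgt0Pl => eps eps0.
have [L Leps] : exists L, b ^+ L / (1 - b) <= eps.
  have /cvgrPdist_le /(_ (eps * (1 - b)) (mulr_gt0 eps0 b1)) [L _ hL] :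
      (b ^+ L @[L --> \oo] --> (0 : R)).
    by apply: cvg_expr; case/andP: b01 => b0 ?; rewrite ger0_norm.
  exists L; have := hL L (leqnn L).
  rewrite /= sub0r normrN ger0_norm ?exprn_ge0 ?ler_pdivrMr//.
  by case/andP: b01.
have := lo L; have := QQ L; have := up L _ (lshift n2) n1p.
have := up L _ (@rshift n1 n2) n2p; nra.
Qed.

End OneStep.

(** * Adding several independent clauses *)

Section Iterates.
Context {R : realType} {k : nat} (mu : {ffun boolfun k -> R}).
Hypothesis hmu : is_pmf mu.

Section Generic.
Variables (s n : nat) (e : 'I_s -> 'I_n).
Hypothesis s0 : (0 < s)%N.

Lemma ler_iter_step m f g S : (forall S', f S' <= g S') ->
  iter m (step mu e) f S <= iter m (step mu e) g S.
Proof. by move=> fg; elim: m S => //= m IH S; apply: ler_step. Qed.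

Lemma iter_step_cst m (a : R) S : iter m (step mu e) (fun=> a) S = a.
Proof.
elim: m S => //= m IH S; rewrite -[RHS](step_cst hmu e a S s0).
by apply: eq_bigr => c _; rewrite IH.
Qed.

Lemma iter_stepD m (a b : R) f g S :
  iter m (step mu e) (fun S => a * f S + b * g S) S =
  a * iter m (step mu e) f S + b * iter m (step mu e) g S.
Proof.
elim: m S => //= m IH S; rewrite -stepD.
by apply: eq_bigr => c _; rewrite IH.
Qed.

Lemma iter_step_antitone m f S :
  (forall S1 S2 : {set cube 'I_n}, S1 \subset S2 -> f S1 <= f S2) ->
  iter m.+1 (step mu e) f S <= iter m (step mu e) f S.
Proof.
move=> fm; rewrite iterSr; apply: ler_iter_step => S'.
rewrite -[leRHS](step_cst hmu e _ S' s0); apply: ler_sum => c _.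
by rewrite ler_wpM2l ?clause_pmf_ge0// fm// finset.subsetIl.
Qed.

Lemma iter_step_monotone m f S :
  (forall S1 S2 : {set cube 'I_n}, S1 \subset S2 -> f S2 <= f S1) ->
  iter m (step mu e) f S <= iter m.+1 (step mu e) f S.
Proof.
move=> fm; rewrite iterSr; apply: ler_iter_step => S'.
rewrite -[leLHS](step_cst hmu e _ S' s0); apply: ler_sum => c _.
by rewrite ler_wpM2l ?clause_pmf_ge0// fm// finset.subsetIl.
Qed.

Lemma iter_stepC s' (e' : 'I_s' -> 'I_n) m f S :
  step mu e' (iter m (step mu e) f) S = iter m (step mu e) (step mu e' f) S.
Proof.
elim: m S => //= m IH S; rewrite stepC.
by apply: eq_bigr => c _; rewrite IH.
Qed.

End Generic.

(** Peels off the clause of index [ord0]. The starting set [S] is arbitrary because the induction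
    hypothesis is used on [S] already cut by that clause. *)
Lemma sum_formula n m f (S : {set cube 'I_n}) :
  \sum_(F : formula k n m) (\prod_a clause_pmf mu n (F a)) *
    f (S :&: [set x : cube 'I_n | satisfies x F]%SET) =
  iter m (step mu id) f S.
Proof.
elim: m S => [|m IH] S.
  rewrite (big_pred1 [ffun i : 'I_0 => False_rect _ (notF (ltn_ord i))]).
    rewrite big_ord0 mul1r /=; congr f; apply/setP => x.
    by rewrite !inE; case: (x \in S) => //=; apply/forallP => -[].
  by move=> F; apply/esym/eqP/ffunP => -[].
rewrite /= {2}/step.
under [RHS]eq_bigr do rewrite -IH mulr_sumr.
rewrite pair_bigA /=.
rewrite (reindex (fun p : clause k n * formula k n m =>
  [ffun a : 'I_m.+1 => oapp p.2 p.1 (unlift ord0 a)])) /=; last first.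
  exists (fun F : formula k n m.+1 => (F ord0, [ffun a => F (lift ord0 a)])).
    move=> [c F] _ /=; congr pair; first by rewrite ffunE unlift_none.
    by apply/ffunP => a; rewrite !ffunE liftK.
  move=> F _ /=; apply/ffunP => a; rewrite ffunE.
  by case: unliftP => [j|] -> //=; rewrite ffunE.
apply: eq_bigr => -[c F] _ /=; set cF : formula k n m.+1 := finfun _.
have cF0 : cF ord0 = c by rewrite ffunE unlift_none.
have cFS a : cF (lift ord0 a) = F a by rewrite ffunE liftK.
rewrite big_ord_recl cF0 mulrA; congr (_ * _ * f _).
  by apply: eq_bigr => a _; rewrite cFS.
rewrite -finset.setIA; congr (S :&: _); apply/setP => x; rewrite !inE.
apply/forallP/andP => [xF|[xc /forallP xF] a].
  split; first by have := xF ord0; rewrite cF0.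
  by apply/forallP => a; have := xF (lift ord0 a); rewrite cFS.
by have [j ->|->] := unliftP ord0 a; [rewrite cFS; exact: xF | rewrite cF0].
Qed.

End Iterates.

(** * Superadditivity of the mean of ln (1 + Z) for two blocks *)

Section Superadditivity.
Context {R : realType} {k : nat} (mu : {ffun boolfun k -> R}).
Hypothesis hmu : is_pmf mu.
Hypothesis hGamma : forall l : nat, (1 <= l)%N -> Gamma_convex mu l.

Definition is_empty n (S : {set cube 'I_n}) : R := (#|S| == 0)%N%:R.

(** By [sum_formula], the mean of ln (1 + Z) for a random formula with exactly [m] clauses; [unsat]
    is likewise the probability that Z = 0. *)
Definition log_nsat n m : R :=
  iter m (step mu id) (@lnp1 R n) [set: cube 'I_n]%SET.

Definition unsat n m : R :=
  iter m (step mu id) (@is_empty n) [set: cube 'I_n]%SET.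

Lemma lnp1_ge0 n (S : {set cube 'I_n}) : 0 <= lnp1 S :> R.
Proof. by rewrite ln_ge0// lerDl. Qed.

Lemma lnp1_le n (S : {set cube 'I_n}) : lnp1 S <= n.+1%:R * ln 2 :> R.
Proof.
rewrite mulr_natl -lnXn// ler_ln ?posrE ?exprn_gt0 ?ltr_wpDr//.
rewrite -natrX nat1r ler_nat; apply: leq_ltn_trans (max_card _) _.
by rewrite card_ffun card_bool card_ord ltn_exp2l.
Qed.

Lemma is_empty_ge0 n (S : {set cube 'I_n}) : 0 <= is_empty S.
Proof. by rewrite /is_empty ler0n. Qed.

Lemma is_empty_le1 n (S : {set cube 'I_n}) : is_empty S <= 1.
Proof. by rewrite /is_empty; case: (_ == _). Qed.

Lemma log_nsat_ge0 n m : (0 < n)%N -> 0 <= log_nsat n m.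
Proof.
move=> n0; rewrite -(iter_step_cst hmu (id : 'I_n -> _) n0 m 0 [set: _]%SET).
by apply: ler_iter_step => // S; exact: lnp1_ge0.
Qed.

Lemma log_nsat_le n m : (0 < n)%N -> log_nsat n m <= n.+1%:R * ln 2.
Proof.
move=> n0; rewrite -[leRHS](iter_step_cst hmu (id : 'I_n -> _) n0 m _ [set: _]%SET).
by apply: ler_iter_step => // S; exact: lnp1_le.
Qed.

Lemma unsat_le1 n m : (0 < n)%N -> unsat n m <= 1.
Proof.
move=> n0; rewrite -[leRHS](iter_step_cst hmu (id : 'I_n -> _) n0 m _ [set: _]%SET).
by apply: ler_iter_step => // S; exact: is_empty_le1.
Qed.

Lemma unsat_ge0 n m : (0 < n)%N -> 0 <= unsat n m.
Proof.
move=> n0; rewrite -[leLHS](iter_step_cst hmu (id : 'I_n -> _) n0 m _ [set: _]%SET).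
by apply: ler_iter_step => // S; exact: is_empty_ge0.
Qed.

Lemma log_nsat_antitone n m m' : (0 < n)%N -> (m <= m')%N ->
  log_nsat n m' <= log_nsat n m.
Proof.
move=> n0 /subnK <-; elim: (m' - m)%N => // d IH; rewrite addSn.
apply: le_trans IH; apply: iter_step_antitone => // S1 S2 S12.
rewrite ler_ln ?posrE ?ltr_wpDr// lerD2l ler_nat.
exact: subset_leq_card.
Qed.

Lemma unsat_monotone n m m' : (0 < n)%N -> (m <= m')%N ->
  unsat n m <= unsat n m'.
Proof.
move=> n0 /subnK <-; elim: (m' - m)%N => // d IH; rewrite addSn.
apply: le_trans IH _; apply: iter_step_monotone => // S1 S2 S12.
rewrite /is_empty; have := subset_leq_card S12.
by case: #|S1| => [|a]; case: #|S2| => [|b].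
Qed.

Section Blocks.
Variables n1 n2 : nat.
Hypotheses (n1p : (0 < n1)%N) (n2p : (0 < n2)%N).
Let p1 : R := n1%:R / (n1 + n2)%:R.
Let p2 : R := n2%:R / (n1 + n2)%:R.

Let np : (0 < n1 + n2)%N. Proof. by rewrite addn_gt0 n1p. Qed.
Let p1_ge0 : 0 <= p1. Proof. by rewrite divr_ge0. Qed.
Let p2_ge0 : 0 <= p2. Proof. by rewrite divr_ge0. Qed.
Let p12 : p1 + p2 = 1.
Proof. by rewrite -mulrDl -natrD divff// pnatr_eq0 -lt0n. Qed.

Definition lproj (x : cube 'I_(n1 + n2)) : cube 'I_n1 := [ffun i => x (lshift n2 i)].
Definition rproj (x : cube 'I_(n1 + n2)) : cube 'I_n2 := [ffun i => x (rshift n1 i)].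

Definition prodset (S1 : {set cube 'I_n1}) (S2 : {set cube 'I_n2}) :
  {set cube 'I_(n1 + n2)} := [set x | (lproj x \in S1) && (rproj x \in S2)]%SET.

Lemma card_prodset S1 S2 : #|prodset S1 S2| = (#|S1| * #|S2|)%N.
Proof.
have inj : injective (fun x => (lproj x, rproj x)).
  move=> x y [/ffunP xl /ffunP xr]; apply/ffunP => i.
  by case: (split_ordP i) => j ->; [have := xl j|have := xr j]; rewrite !ffunE.
rewrite -cardsX -(card_imset (mem (prodset S1 S2)) inj); apply: eq_card => -[y z].
rewrite inE /=; apply/imsetP/andP => [[x xS [-> ->]]|[yS zS]].
  by move: xS; rewrite inE => /andP.
exists [ffun i => match fintype.split i with inl a => y a | inr b => z b end].
  rewrite inE; apply/andP; split.
    rewrite (_ : lproj _ = y)//; apply/ffunP => i.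
    by rewrite !ffunE (unsplitK (inl i)).
  rewrite (_ : rproj _ = z)//; apply/ffunP => i.
  by rewrite !ffunE (unsplitK (inr i)).
by congr pair; apply/ffunP => i;
  rewrite !ffunE ?(unsplitK (inl i)) ?(unsplitK (inr i)).
Qed.

Lemma prodset_satsl S1 S2 (c : clause k n1) :
  prodset S1 S2 :&: sats (lshift n2) c = prodset (S1 :&: sats id c) S2.
Proof.
apply/setP => x; rewrite !inE [RHS]andbAC; congr (_ && c.1 _).
by apply/ffunP => j; rewrite !ffunE.
Qed.

Lemma prodset_satsr S1 S2 (c : clause k n2) :
  prodset S1 S2 :&: sats (@rshift n1 n2) c = prodset S1 (S2 :&: sats id c).
Proof.
apply/setP => x; rewrite !inE [RHS]andbA; congr (_ && c.1 _).
by apply/ffunP => j; rewrite !ffunE.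
Qed.

(** One random clause confined to a block chosen with probability proportional to its size. *)
Definition split_step f (S : {set cube 'I_(n1 + n2)}) : R :=
  p1 * step mu (lshift n2) f S + p2 * step mu (@rshift n1 n2) f S.

Lemma ler_split_step f g S :
  (forall S', f S' <= g S') -> split_step f S <= split_step g S.
Proof. by move=> fg; rewrite lerD// ler_wpM2l// ler_step. Qed.

(** Clauses are exchanged one at a time. [step_lnp1] only speaks of the function [lnp1], so the
    steps are commuted to make the clause being exchanged the innermost one. *)
Lemma iter_split_step_le m (S : {set cube 'I_(n1 + n2)}) :
  iter m split_step (@lnp1 R _) S <= iter m (step mu id) (@lnp1 R _) S.
Proof.
elim: m S => // m IH S; rewrite iterS.
apply: (le_trans (ler_split_step S IH)).
rewrite /split_step !iter_stepC -iter_stepD iterSr.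
by apply: ler_iter_step => // S'; exact: step_lnp1.
Qed.

Lemma binE_step q m n (F : nat -> {set cube 'I_n} -> R) S :
  step mu id (fun S => binE q m (fun j => F j S)) S =
  binE q m (fun j => step mu id (F j) S).
Proof.
elim: m F => //= m IH F; rewrite stepD; congr (_ * _ + _ * _); last exact: IH.
exact: (IH (fun j => F j.+1)).
Qed.

(** Block clauses preserve products of solution sets, and each block receives a binomial number of
    them. The two numbers are dependent, but the lower bound is a sum, so only their marginal laws
    enter. *)
Lemma iter_split_step_ge m f f1 f2 S1 S2 :
  (forall S1 S2, f1 S1 + f2 S2 <= f (prodset S1 S2)) ->
  binE p1 m (fun j => iter j (step mu id) f1 S1) +
  binE p2 m (fun j => iter j (step mu id) f2 S2) <=
  iter m split_step f (prodset S1 S2).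
Proof.
move=> ff; elim: m S1 S2 => // m IH S1 S2; rewrite iterS.
set g1 := fun S => binE p1 m (fun j => iter j (step mu id) f1 S).
set g2 := fun S => binE p2 m (fun j => iter j (step mu id) f2 S).
rewrite -/g1 -/g2 in IH.
have q1 : 1 - p1 = p2 by rewrite -p12; ring.
have q2 : 1 - p2 = p1 by rewrite -p12; ring.
rewrite /= q1 q2 -/(g1 S1) -/(g2 S2) -!binE_step -/g1 -/g2.
have h1 : step mu id g1 S1 + g2 S2 <=
    step mu (lshift n2) (iter m split_step f) (prodset S1 S2).
  rewrite -[g2 S2](step_cst hmu id _ S1 n1p) /step -big_split /=.
  apply: ler_sum => c _; rewrite -mulrDr prodset_satsl.
  by apply: ler_wpM2l; [exact: clause_pmf_ge0 | exact: IH].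
have h2 : g1 S1 + step mu id g2 S2 <=
    step mu (@rshift n1 n2) (iter m split_step f) (prodset S1 S2).
  rewrite -[g1 S1](step_cst hmu id _ S2 n2p) /step -big_split /=.
  apply: ler_sum => c _; rewrite -mulrDr prodset_satsr.
  by apply: ler_wpM2l; [exact: clause_pmf_ge0 | exact: IH].
have := ler_wpM2l p1_ge0 h1; have := ler_wpM2l p2_ge0 h2.
rewrite /split_step; lra.
Qed.

(** If both sets are nonempty, 1 + a <= 2 a costs ln 2 per block. If [S1] is empty, ln (1 + #|S2|)
    <= (n2 + 1) ln 2 is absorbed by the penalty on [S1], and symmetrically. The left side has the
    linear shape of [iter_stepD]. *)
Lemma lnp1_prodset S1 S2 :
  (1 * lnp1 S1 + (- ln 2) * (1 + n2%:R * is_empty S1)) +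
  (1 * lnp1 S2 + (- ln 2) * (1 + n1%:R * is_empty S2)) <=
  lnp1 (prodset S1 S2) :> R.
Proof.
have ln2_ge0 : 0 <= ln 2 :> R by rewrite ln_ge0// ler1n.
have lnp1_le2 a : (0 < a)%N -> ln (1 + a%:R) <= ln 2 + ln a%:R :> R.
  move=> a0; rewrite -lnM ?posrE ?ltr0n// ler_ln ?posrE ?mulr_gt0 ?ltr0n ?ltr_wpDr//.
  have : 1 <= a%:R :> R by rewrite ler1n.
  lra.
have := lnp1_le S1; have := lnp1_le S2.
rewrite -[n1.+1%:R]natr1 -[n2.+1%:R]natr1.
have := lnp1_ge0 (prodset S1 S2).
rewrite /lnp1 /is_empty card_prodset.
have [->|a0] := posnP #|S1|; have [->|b0] := posnP #|S2|.
- rewrite /= !mulr0n !addr0 !ln1; nra.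
- rewrite /= ?mul0n ?muln0 !mulr0n !addr0 !ln1; nra.
- rewrite /= ?mul0n ?muln0 !mulr0n !addr0 !ln1; nra.
move=> _ _ _; rewrite /= !mulr0n.
have := lnp1_le2 _ a0; have := lnp1_le2 _ b0.
have : ln #|S1|%:R + ln #|S2|%:R <= ln (1 + (#|S1| * #|S2|)%:R) :> R.
  rewrite -lnM ?posrE ?ltr0n// ler_ln ?posrE ?mulr_gt0 ?ltr0n ?ltr_wpDr//.
  by rewrite natrM lerDr.
lra.
Qed.

Lemma log_nsat_superadd m :
  binE p1 m (log_nsat n1) + binE p2 m (log_nsat n2)
  - ln 2 * (2%:R + n2%:R * binE p1 m (unsat n1) + n1%:R * binE p2 m (unsat n2))
  <= log_nsat (n1 + n2) m.
Proof.
have setTE : [set: cube 'I_(n1 + n2)]%SET = prodset [set: _]%SET [set: _]%SET.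
  by apply/setP => x; rewrite !inE.
rewrite /log_nsat setTE; apply: le_trans (iter_split_step_le _ _).
apply: le_trans (iter_split_step_ge m _ _ lnp1_prodset).
have E s (q b : R) : (0 < s)%N ->
    binE q m (fun j => iter j (step mu id)
      (fun S => 1 * lnp1 S + - ln 2 * (1 + b * is_empty S)) [set: cube 'I_s]%SET) =
    binE q m (log_nsat s) - ln 2 * (1 + b * binE q m (unsat s)).
  move=> s0.
  transitivity (binE q m (fun j => log_nsat s j + - ln 2 * (1 + b * unsat s j))).
    apply: eq_binE => j; rewrite iter_stepD mul1r; congr (_ + _ * _).
    rewrite -[X in X + _](iter_step_cst hmu (id : 'I_s -> _) s0 j 1 [set: _]%SET).
    rewrite -[X in X + _]mul1r -iter_stepD.
    by congr (iter j _ _ _); apply/funext => S; rewrite mul1r.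
  by rewrite binED binEZ binED binE_cst binEZ mulNr.
rewrite !E//; lra.
Qed.

End Blocks.
End Superadditivity.

(** * Splitting into blocks *)

Section DyadicSplitting.
Context {R : realFieldType}.

(** Halves a row of q blocks of size n0, the last one carrying the remainder r. Each of the j levels
    loses an amount proportional to the number of variables, so the losses per variable add up over
    levels. *)
Lemma dyadic_superadd (X U D : nat -> R) (b : R) (N n0 : nat) :
  0 <= b -> (0 < n0)%N -> (forall i, 0 <= D i) ->
  (forall s, (0 < s)%N -> 0 <= X s) ->
  (forall s1 s2, (0 < s1)%N -> (0 < s2)%N -> (s1 + s2 <= N)%N ->
    X s1 + X s2 - b * (2%:R + s2%:R * U s1 + s1%:R * U s2) <= X (s1 + s2)%N) ->
  (forall i s, (2 ^ i * n0 <= 2 * s)%N -> (n0 <= s <= N)%N -> U s <= D i) ->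
  forall j q r, (0 < q <= 2 ^ j)%N -> (r < n0)%N -> (q * n0 + r <= N)%N ->
    (q%:R - (0 < r)%N%:R) * X n0 -
      (q * n0 + r)%:R * \sum_(i < j) b * (2%:R / (2 ^ i * n0)%:R + D i)
    <= X (q * n0 + r)%N.
Proof.
move=> b0 n00 D0 X0 hX hU; elim=> [|j IH] q r /andP[q0 qj] rn sN.
  have -> : q = 1%N by case: q q0 qj {sN} => [|[]].
  (* A block enlarged by the remainder is only bounded below by 0, hence the loss of one block when
     r > 0. *)
  rewrite big_ord0 mulr0 subr0 mul1n; case: (posnP r) => [->|r0] /=.
    by rewrite subr0 mul1r addn0.
  by rewrite subrr mul0r X0// addn_gt0 n00.
set c := fun i : nat => b * (2%:R / (2 ^ i * n0)%:R + D i).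
have c0 i : 0 <= c i by rewrite mulr_ge0// addr_ge0// divr_ge0.
have V0 : 0 <= \sum_(i < j) c i by rewrite sumr_ge0.
rewrite big_ord_recr /= -/(c j).
have [qj'|qj'] := leqP q (2 ^ j).
  apply: le_trans (IH q r _ rn sN); last by rewrite q0.
  by rewrite lerD2l lerN2 ler_wpM2l// lerDl.
have jp : (0 < 2 ^ j)%N by rewrite expn_gt0.
rewrite expnS in qj.
pose q1 := q./2; pose q2 := (q - q./2)%N.
have q12 : q = (q1 + q2)%N by rewrite /q1 /q2; lia.
have [q1p q2p q1j q2j] : [/\ 0 < q1, 0 < q2, q1 <= 2 ^ j & q2 <= 2 ^ j]%N.
  by rewrite /q1 /q2; split; lia.
(* Each half has at least 2^j / 2 blocks, which is why the hypothesis on [U] has the factor 2. *)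
have qq : (2 ^ j <= 2 * q1)%N by rewrite /q1; lia.
have qq2 : (2 ^ j <= 2 * q2)%N by rewrite /q2; lia.
have sE : (q * n0 + r = q1 * n0 + 0 + (q2 * n0 + r))%N by rewrite q12; lia.
have s1N : (q1 * n0 + 0 <= N)%N by lia.
have s2N : (q2 * n0 + r <= N)%N by lia.
have h1 := IH q1 0%N; rewrite q1p q1j n00 s1N in h1.
have {}h1 := h1 isT isT isT.
have h2 := IH q2 r; rewrite q2p q2j rn s2N in h2.
have {}h2 := h2 isT isT isT.
have s1p : (0 < q1 * n0 + 0)%N by rewrite addn0 muln_gt0 q1p.
have s2p : (0 < q2 * n0 + r)%N by rewrite addn_gt0 muln_gt0 q2p n00.
have u1 : U (q1 * n0 + 0)%N <= D j.
  apply: hU; first by rewrite addn0 mulnA leq_pmul2r.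
  by rewrite s1N addn0 leq_pmull.
have u2 : U (q2 * n0 + r)%N <= D j.
  apply: hU; last by rewrite s2N andbT (leq_trans (leq_pmull _ q2p))// leq_addr.
  by rewrite mulnDr mulnA (leq_trans _ (leq_addr _ _))// leq_pmul2r.
have := hX _ _ s1p s2p; rewrite -sE => /(_ sN).
have sR : (q * n0 + r)%:R =
  (q1 * n0 + 0)%:R + (q2 * n0 + r)%:R :> R by rewrite sE natrD.
have qR : q%:R = q1%:R + q2%:R :> R by rewrite q12 natrD.
have e1 := ler_wpM2l (ler0n R (q2 * n0 + r)) u1.
have e2 := ler_wpM2l (ler0n R (q1 * n0 + 0)) u2.
(* The constant 2 is paid once for a merged block of at least 2^j n0 variables. *)
have e3 : 2%:R <= (q * n0 + r)%:R * (2%:R / (2 ^ j * n0)%:R) :> R.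
  rewrite mulrCA ler_peMr// ler_pdivlMr ?mul1r ?ltr0n ?muln_gt0 ?jp// ler_nat.
  by rewrite (leq_trans _ (leq_addr _ _))// leq_mul2r ltnW ?orbT.
have e4 : b * (2%:R + (q2 * n0 + r)%:R * U (q1 * n0 + 0)%N
     + (q1 * n0 + 0)%:R * U (q2 * n0 + r)%N) <= (q * n0 + r)%:R * c j.
  rewrite /c mulrCA ler_wpM2l// mulrDr {2}sR; lra.
rewrite -/c in h1 h2; set V := \sum_(i < j) _ in h1 h2 V0 *.
move: h1 h2 e4; rewrite qR sR /= subr0.
set S1 := (_ + 0)%:R; set S2 := (_ + r)%:R => h1 h2 e4 h; lra.
Qed.

End DyadicSplitting.

(** * Summability of the errors over the levels *)

Section Tail.
Context {R : realType}.

(** The comparison of t^-(1 + eps) with its integral, obtained from 1 / (t + 1) <= ln (t + 1) - ln t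
    and 1 + u <= exp u. *)
Lemma invr_powR_le_telescope (eps : R) (t : nat) : 0 < eps -> (0 < t)%N ->
  (t.+1%:R `^ (1 + eps))^-1 <=
  eps^-1 * ((t%:R `^ eps)^-1 - (t.+1%:R `^ eps)^-1).
Proof.
move=> eps0 t0; have tp : 0 < t%:R :> R by rewrite ltr0n.
have t1p : 0 < t.+1%:R :> R by rewrite ltr0n.
rewrite /powR !gt_eqF// -!expRN.
set x := ln t%:R; set y := ln t.+1%:R.
have xy : expR (- y) <= y - x.
  rewrite expRN lnK ?posrE//.
  have -> : y - x = - ln (1 + - t.+1%:R^-1).
    rewrite /x /y -[ln _ - ln _]opprB -ln_div ?posrE//; congr (- ln _).
    by rewrite -natr1; field; rewrite natr1 gt_eqF.
  rewrite lerNr; apply: le_ln1Dx; rewrite ltrN2.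
  by rewrite invf_lt1// ltr1n ltnS.
rewrite ler_pdivlMl//.
have -> : expR (- (eps * x)) = expR (- (eps * y)) * expR (eps * (y - x)).
  by rewrite -expRD; congr expR; ring.
have -> : expR (- ((1 + eps) * y)) = expR (- (eps * y)) * expR (- y).
  by rewrite -expRD; congr expR; ring.
rewrite mulrCA -[X in _ - X]mulr1 -mulrBr ler_wpM2l ?expR_ge0//.
have := expR_ge1Dx (eps * (y - x)); have := ler_wpM2l (ltW eps0) xy; lra.
Qed.

(** At level i the blocks will have at least 2^(i + J + 1) variables, with logarithm of order i + J
    + 1; this controls the resulting errors uniformly in the number of levels. *)
Lemma log_tail (A B eps delta : R) (J0 : nat) :
  0 <= A -> 0 <= B -> 0 < eps -> 0 < delta ->
  exists2 J, (J0 <= J)%N & forall j, \sum_(i < j)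
    (A * ((i + J).+1%:R `^ (1 + eps))^-1 + B * (2 ^+ (i + J).+1)^-1) <= delta.
Proof.
move=> A0 B0 eps0 d0.
(* Its decrements dominate the summands; [J1] and [J2] make each of its two terms at most delta / 2
   at [J]. *)
pose pot t : R := A / eps * (t%:R `^ eps)^-1 + B * (2 ^+ t)^-1.
pose J1 := (Num.truncn ((2%:R * A / (eps * delta)) `^ eps^-1)).+1.
pose J2 := (Num.truncn (2%:R * B / delta)).+1.
pose J := maxn (maxn J0 J1) J2.
have J0J : (J0 <= J)%N by rewrite /J !leq_max leqnn.
have J1J : J1%:R <= J%:R :> R by rewrite ler_nat /J !leq_max leqnn orbT.
have J2J : J2%:R <= J%:R :> R by rewrite ler_nat /J !leq_max leqnn orbT.
have Jp : (0 < J)%N by rewrite /J !leq_max orbT.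
have JR : 0 < J%:R :> R by rewrite ltr0n.
clearbody J; exists J => // j; apply: le_trans (_ : pot J - pot (j + J)%N <= _).
  elim: j => [|j IH]; first by rewrite big_ord0 subrr.
  rewrite big_ord_recr /= addSn.
  have h : (A * ((j + J).+1%:R `^ (1 + eps))^-1 + B * (2 ^+ (j + J).+1)^-1)
      <= pot (j + J)%N - pot (j + J).+1.
    have jJ : (0 < j + J)%N by rewrite addn_gt0 Jp orbT.
    have := ler_wpM2l A0 (invr_powR_le_telescope eps0 jJ).
    rewrite /pot exprS invfM; set z := (2 ^+ (j + J))^-1.
    have -> : 2^-1 * z = z / 2 by rewrite mulrC.
    lra.
  by apply: le_trans (lerD IH h) _; rewrite addrA subrK.
have pot0 t : 0 <= pot t.
  by rewrite addr_ge0// mulr_ge0 ?invr_ge0 ?powR_ge0 ?exprn_ge0 ?divr_ge0 ?(ltW eps0).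
have : pot J <= delta / 2 + delta / 2.
  apply: lerD.
    rewrite ler_pdivrMr ?powR_gt0//.
    have h : 2%:R * A / (eps * delta) <= J%:R `^ eps.
      have q0 : 0 <= 2%:R * A / (eps * delta).
        by rewrite divr_ge0 ?mulr_ge0// ltW.
      have -> : 2%:R * A / (eps * delta) =
          ((2%:R * A / (eps * delta)) `^ eps^-1) `^ eps.
        by rewrite -powRrM mulVf ?gt_eqF// powRr1.
      apply: ge0_ler_powR; rewrite ?nnegrE ?powR_ge0 ?ltW//.
      exact: lt_le_trans (truncnS_gt _) J1J.
    rewrite ler_pdivrMr//; rewrite ler_pdivrMr ?mulr_gt0// in h; lra.
  rewrite ler_pdivrMr ?exprn_gt0//.
  have h : 2%:R * B / delta <= J%:R.
    by apply: ltW; exact: lt_le_trans (truncnS_gt _) J2J.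
  have h2 : J%:R <= 2 ^+ J :> R by rewrite -natrX ler_nat ltnW// ltn_expl.
  rewrite ler_pdivrMr// in h; set z := 2 ^+ J in h2 *; clearbody z; nra.
have := pot0 (j + J)%N; lra.
Qed.

End Tail.

Section BlockBound.
Context {R : realType} {k : nat} (mu : {ffun boolfun k -> R}).
Hypothesis hmu : is_pmf mu.
Hypothesis hGamma : forall l : nat, (1 <= l)%N -> Gamma_convex mu l.

Lemma frac01 (s N : nat) : (0 < s <= N)%N -> 0 <= (s%:R / N%:R : R) <= 1.
Proof.
move=> /andP[s0 sN]; rewrite divr_ge0//= ler_pdivrMr ?mul1r ?ler_nat//.
by rewrite ltr0n (leq_trans s0).
Qed.

(** A block of s variables receives at most a0 s clauses on average, and more than a1 s with
    probability O(1/s) by Chebyshev; otherwise [unsat] is monotone in the number of clauses. *)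
Lemma unsat_block_le (a0 a1 : R) (s N M : nat) : 0 <= a0 < a1 ->
  (0 < s <= N)%N -> M%:R <= a0 * N%:R ->
  binE (s%:R / N%:R) M (unsat mu s) <=
  unsat mu s (Num.truncn (a1 * s%:R)) + a0 / (a1 - a0) ^+ 2 * s%:R^-1.
Proof.
move=> /andP[a00 a01] sN MN; have p01 := frac01 sN.
have /andP[s0 sN'] := sN.
have sp : 0 < s%:R :> R by rewrite ltr0n.
have Np : 0 < N%:R :> R by rewrite ltr0n (leq_trans s0).
set p := s%:R / N%:R in p01 *.
have pM : p * M%:R <= a0 * s%:R.
  have -> : a0 * s%:R = p * (a0 * N%:R) by rewrite /p; field; rewrite gt_eqF.
  by rewrite ler_wpM2l//; case/andP: p01.
have pMs : p * M%:R < a1 * s%:R.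
  by apply: le_lt_trans pM _; rewrite ltr_pM2r.
apply: le_trans (_ : binE p M (fun j => unsat mu s (Num.truncn (a1 * s%:R)) +
    (a1 * s%:R < j%:R)%R%:R) <= _).
  apply: ler_binE => // j; have [sj|js] := ltP (a1 * s%:R) j%:R.
    rewrite -[leLHS]add0r lerD ?unsat_ge0//; exact: unsat_le1.
  rewrite addr0 unsat_monotone// truncn_ge_nat//.
  by rewrite mulr_ge0// (le_trans a00) ?ltW.
rewrite binED binE_cst lerD2l; apply: le_trans (binE_chebyshev p01 pMs) _.
have d0 : 0 < (a1 - a0) * s%:R by rewrite mulr_gt0// subr_gt0.
have -> : a0 / (a1 - a0) ^+ 2 * s%:R^-1 = a0 * s%:R / ((a1 - a0) * s%:R) ^+ 2.
  by field; rewrite !gt_eqF// subr_gt0.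
apply: ler_pM => //.
- by rewrite mulr_ge0//; case/andP: p01.
- by rewrite invr_ge0 sqr_ge0.
rewrite lef_pV2 ?posrE ?exprn_gt0//; last by rewrite subr_gt0.
rewrite ler_sqr ?nnegrE ?(ltW d0)//; first by lra.
by rewrite subr_ge0 ltW.
Qed.

(** Conditionally on the number of clauses in the merged block this is [log_nsat_superadd]; thinning
    brings all binomials back to the M clauses on N variables. *)
Lemma block_superadd (N M s1 s2 : nat) : (0 < s1)%N -> (0 < s2)%N ->
  (s1 + s2 <= N)%N ->
  binE (s1%:R / N%:R) M (log_nsat mu s1) +
  binE (s2%:R / N%:R) M (log_nsat mu s2) -
  ln 2 * (2%:R + s2%:R * binE (s1%:R / N%:R) M (unsat mu s1)
    + s1%:R * binE (s2%:R / N%:R) M (unsat mu s2))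
  <= binE ((s1 + s2)%:R / N%:R) M (log_nsat mu (s1 + s2)).
Proof.
move=> s1p s2p sN.
have sp : (0 < s1 + s2)%N by rewrite addn_gt0 s1p.
have E s (f : nat -> R) : binE (s%:R / N%:R) M f =
    binE ((s1 + s2)%:R / N%:R) M (fun j => binE (s%:R / (s1 + s2)%:R) j f).
  rewrite binE_thin; congr binE; rewrite [RHS]mulrC mulrA divfK//.
  by rewrite pnatr_eq0 -lt0n.
rewrite (E s1 (log_nsat mu s1)) (E s2 (log_nsat mu s2)).
rewrite (E s1 (unsat mu s1)) (E s2 (unsat mu s2)).
set P : R := (s1 + s2)%:R / N%:R.
have P01 : 0 <= P <= 1 by apply: frac01; rewrite sp.
apply: le_trans (ler_binE M P01 (f := fun j =>
  binE (s1%:R / (s1 + s2)%:R) j (log_nsat mu s1) +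
  binE (s2%:R / (s1 + s2)%:R) j (log_nsat mu s2) +
  - ln 2 * (2%:R + s2%:R * binE (s1%:R / (s1 + s2)%:R) j (unsat mu s1) +
    s1%:R * binE (s2%:R / (s1 + s2)%:R) j (unsat mu s2))) _).
  by rewrite !(binED, binEZ) binE_cst mulNr.
by move=> j; rewrite mulNr; exact: log_nsat_superadd.
Qed.

Variables a0 a1 C eps : R.
Variable T : nat.
Hypotheses (a00 : 0 <= a0) (a01 : a0 < a1) (eps0 : 0 < eps) (C0 : 0 <= C).
Hypothesis unsat_decay : forall n, (T <= n)%N ->
  unsat mu n (Num.truncn (a1 * n%:R)) <= C * (ln n%:R `^ (1 + eps))^-1.

Lemma log_nsat_block (delta : R) : 0 < delta ->
  exists2 N1 : nat, (0 < N1)%N & forall n0, (N1 <= n0)%N ->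
  exists N2 : nat, forall N M, (N2 <= N)%N -> M%:R <= a0 * N%:R ->
  binE (n0%:R / N%:R) M (log_nsat mu n0) / n0%:R - delta
    <= log_nsat mu N M / N%:R.
Proof.
move=> d0; have ln20 : 0 < ln 2 :> R by rewrite ln_gt0// ltr1n.
(* From s >= 2^t follows ln s >= t ln 2, which gives [A]; [B] is the Chebyshev constant, and the 2
   added to it below accounts for the terms 2 / (2^i n0). *)
pose A := C * (ln 2 `^ (1 + eps))^-1.
pose B := a0 / (a1 - a0) ^+ 2.
have A0 : 0 <= A by rewrite mulr_ge0// invr_ge0 powR_ge0.
have B0 : 0 <= B by rewrite divr_ge0// sqr_ge0.
have d2 : 0 < delta / 2 by rewrite divr_gt0.
have [J TJ hJ] := @log_tail R (ln 2 * A) (ln 2 * (B + 2%:R)) eps (delta / 2) T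
  (mulr_ge0 (ltW ln20) A0) (mulr_ge0 (ltW ln20) (addr_ge0 B0 (ler0n _ _))) eps0
  d2.
(* Then 2^i n0 <= 2 s forces s >= 2^(i + J + 1). *)
exists (2 ^ J.+2)%N; first by rewrite expn_gt0.
move=> n0 Jn0; have n00 : (0 < n0)%N by rewrite (leq_trans _ Jn0)// expn_gt0.
(* Rounding N / n0 and the remainder lose at most two blocks, each worth at most (n0 + 1) ln 2; for
   N >= K this is at most N delta / 2. *)
pose K := 4%:R * n0.+1%:R * ln 2 / delta.
exists (maxn n0 (Num.truncn K).+1) => N M; rewrite geq_max => /andP[n0N KN] MN.
have NR : 0 < N%:R :> R by rewrite ltr0n (leq_trans n00).
have n0R : 0 < n0%:R :> R by rewrite ltr0n.
pose X s := binE (s%:R / N%:R) M (log_nsat mu s).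
have X_ge0 s : (0 < s <= N)%N -> 0 <= X s.
  move=> sN; rewrite -(binE_cst (s%:R / N%:R) M 0).
  apply: ler_binE => [|j]; first exact: frac01.
  by apply: log_nsat_ge0 => //; case/andP: sN.
pose D i : R := A * ((i + J).+1%:R `^ (1 + eps))^-1 + B * (2 ^+ (i + J).+1)^-1.
have D0 i : 0 <= D i.
  by rewrite addr_ge0// mulr_ge0// invr_ge0 ?powR_ge0 ?exprn_ge0.
have UD i s : (2 ^ i * n0 <= 2 * s)%N -> (n0 <= s <= N)%N ->
    binE (s%:R / N%:R) M (unsat mu s) <= D i.
  move=> is_ /andP[n0s sN].
  have sp : (0 < s)%N by rewrite (leq_trans n00).
  have e2 : (2 ^ (i + J).+1 <= s)%N.
    rewrite -(leq_pmul2l (isT : (0 < 2)%N)); apply: leq_trans is_.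
    by rewrite -expnS -addnS -addnS expnD leq_pmul2l ?expn_gt0.
  have Ts : (T <= s)%N.
    apply: leq_trans e2; apply: leq_trans (ltnW (ltn_expl _ (isT : (1 < 2)%N))).
    by rewrite (leq_trans TJ)// leqW// leq_addl.
  have e2R : 2 ^+ (i + J).+1 <= s%:R :> R by rewrite -natrX ler_nat.
  have pR : 0 < 2 ^+ (i + J).+1 :> R by rewrite exprn_gt0.
  apply: le_trans (@unsat_block_le a0 a1 s N M _ _ MN) _.
  - by rewrite a00.
  - by rewrite sp.
  apply: lerD.
    apply: le_trans (unsat_decay Ts) _; rewrite /A -mulrA -invfM ler_wpM2l//.
    have tR : 0 < (i + J).+1%:R :> R by rewrite ltr0n.
    rewrite -powRM ?(ltW ln20) ?(ltW tR)// lef_pV2 ?posrE ?powR_gt0 ?mulr_gt0//.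
      apply: ge0_ler_powR; rewrite ?nnegrE ?mulr_ge0 ?(ltW ln20)//.
      - by rewrite addr_ge0// ltW.
      - by rewrite ln_ge0// ler1n.
      by rewrite mulr_natr -lnXn// ler_ln ?posrE// ltr0n.
    by rewrite ln_gt0// (lt_le_trans _ e2R)// exprn_egt1// ltr1n.
  by rewrite ler_wpM2l// lef_pV2 ?posrE// ltr0n.
pose q := (N %/ n0)%N; pose r := (N %% n0)%N.
have q0 : (0 < q)%N by rewrite divn_gt0.
have NE : (q * n0 + r = N)%N by rewrite -divn_eq.
(* Beyond N the ratio s / N is no longer a probability, so nonnegativity is enforced by
   truncation. *)
pose X' s := if (s <= N)%N then X s else 0.
have h1 s : (0 < s)%N -> 0 <= X' s.
  by rewrite /X' => s0; case: leqP => // sN; rewrite X_ge0 ?s0.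
have h2 s1 s2 : (0 < s1)%N -> (0 < s2)%N -> (s1 + s2 <= N)%N ->
  X' s1 + X' s2 - ln 2 * (2%:R + s2%:R * binE (s1%:R / N%:R) M (unsat mu s1)
    + s1%:R * binE (s2%:R / N%:R) M (unsat mu s2)) <= X' (s1 + s2)%N.
  move=> s1p s2p sN; rewrite /X' sN.
  rewrite (leq_trans (leq_addr _ _) sN) (leq_trans (leq_addl _ _) sN).
  exact: block_superadd.
(* Since q <= 2^q, q levels suffice; this crude number is harmless as the error bound is uniform in
   it. *)
have := dyadic_superadd (ltW ln20) n00 D0 h1 h2 UD (j := q) (q := q) (r := r).
rewrite NE q0 /= /X' leqnn n0N => /(_ (ltnW (ltn_expl _ (isT : (1 < 2)%N)))).
move=> /(_ (ltn_pmod _ n00) isT).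
set Sg := \sum_(i < q) _.
have Sle : Sg <= delta / 2.
  apply: le_trans (hJ q); apply: ler_sum => i _.
  have : 2%:R / (2 ^ i * n0)%:R <= 2%:R * (2 ^+ (i + J).+1)^-1 :> R.
    rewrite ler_pM2l// lef_pV2 ?posrE ?exprn_gt0 ?ltr0n ?muln_gt0 ?expn_gt0//.
    rewrite -natrX ler_nat -addnS expnD leq_pmul2l ?expn_gt0//.
    by apply: leq_trans Jn0; rewrite leq_exp2l.
  move=> /(ler_wpM2l (ltW ln20)); rewrite /D; lra.
have XN : X N = log_nsat mu N M by rewrite /X divff ?gt_eqF// binE1.
have Xn0 := X_ge0 n0; rewrite n00 n0N in Xn0; have {}Xn0 := Xn0 isT.
rewrite XN => H.
have Xn0u : X n0 <= n0.+1%:R * ln 2.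
  rewrite -[leRHS](binE_cst (n0%:R / N%:R) M); apply: ler_binE => [|j].
    by apply: frac01; rewrite n00.
  exact: log_nsat_le.
rewrite ler_pdivlMr// -/(X n0).
have qN : N%:R / n0%:R - 2%:R <= q%:R - (0 < r)%N%:R :> R.
  rewrite lerBlDr ler_pdivrMr// -NE natrD natrM.
  have rn : r%:R <= n0%:R :> R by rewrite ler_nat ltnW// ltn_pmod.
  have r1 : (0 < r)%N%:R <= 1 :> R by case: (0 < r)%N.
  nra.
have hK : 4%:R * n0.+1%:R * ln 2 <= N%:R * delta.
  rewrite -ler_pdivrMr// -/K; apply: ltW; apply: lt_le_trans (truncnS_gt _) _.
  by rewrite ler_nat.
have g1 := ler_wpM2r Xn0 qN.
have g2 := ler_wpM2l (ltW NR) Sle.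
have -> : (X n0 / n0%:R - delta) * N%:R = N%:R / n0%:R * X n0 - N%:R * delta by ring.
lra.
Qed.

End BlockBound.

(** * Convergence *)

Section BinomialMedian.
Context {R : realType}.

Lemma nclausesP (alpha : R) n : 0 <= alpha ->
  (nclauses alpha n)%:R <= alpha * n%:R < (nclauses alpha n)%:R + 1.
Proof. by move=> a0; rewrite natr1 /nclauses truncn_itv// mulr_ge0. Qed.

(** The variance is at least 1: 2 n0 <= N gives 1 - p >= 1/2, and the mean is at least alpha n0 - 1
    >= 2. For alpha = 0 there are no clauses. *)
Lemma binE_nclauses_le_mean (alpha : R) (n0 N : nat) : 0 <= alpha ->
  (0 < n0)%N -> (2 * n0 <= N)%N -> alpha = 0 \/ 3%:R <= alpha * n0%:R ->
  16%:R^-1 <= binE (n0%:R / N%:R) (nclauses alpha N)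
    (fun j => (j%:R <= alpha * n0%:R)%R%:R) :> R.
Proof.
move=> a0 n00 nN cases.
have Np : 0 < N%:R :> R by rewrite ltr0n; lia.
have n0p : 0 < n0%:R :> R by rewrite ltr0n.
have nN2 : 2%:R * n0%:R <= N%:R :> R by rewrite -natrM ler_nat.
set p : R := n0%:R / N%:R.
have p2 : 0 <= p <= 1 / 2.
  by rewrite /p divr_ge0//= ler_pdivrMr//; lra.
have p01 : 0 <= p <= 1 by lra.
case: cases => [->|an].
  rewrite /nclauses mul0r truncn0 /= mul0r lexx /= invf_le1//; lra.
have /andP[M1 M2] := nclausesP N a0; set M := nclauses alpha N in M1 M2 *.
have pN : p * N%:R = n0%:R by rewrite /p divfK// gt_eqF.
have pM1 : p * M%:R <= alpha * n0%:R.
  by rewrite -pN mulrCA ler_wpM2l//; case/andP: p01.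
have pM2 : alpha * n0%:R - 1 <= p * M%:R.
  rewrite -pN mulrCA; clear -M2 p01; nra.
have v1 : 1 <= M%:R * (p * (1 - p)) by clear -pM2 an p2; nra.
set v := M%:R * (p * (1 - p)) in v1.
have v0 : 0 < v by lra.
have t1 : 1 <= Num.sqrt v by rewrite -[leLHS]sqrtr1 ler_sqrt ?nnegrE ?(ltW v0).
have t2 : Num.sqrt v ^+ 2 = v by rewrite sqr_sqrtr ?ltW.
have t0 : 0 < Num.sqrt v by rewrite sqrtr_gt0.
apply: le_trans (binE_le_mean p01 t0 t2 t1) _; apply: ler_binE => // j.
rewrite ler_nat; have [jp|//] := lerP j%:R (p * M%:R).
by rewrite (le_trans jp).
Qed.

End BinomialMedian.

Section Limit.
Context {R : realType} {k : nat} (mu : {ffun boolfun k -> R}).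
Hypothesis hmu : is_pmf mu.
Variables a0 alpha : R.
Hypotheses (alpha0 : 0 <= alpha) (alpha_lt : alpha < a0).
Hypothesis block : forall delta : R, 0 < delta ->
  exists2 N1 : nat, (0 < N1)%N & forall n0, (N1 <= n0)%N ->
  exists N2 : nat, forall N M, (N2 <= N)%N -> M%:R <= a0 * N%:R ->
  binE (n0%:R / N%:R) M (log_nsat mu n0) / n0%:R - delta
    <= log_nsat mu N M / N%:R.

Let x n0 N := binE (n0%:R / N%:R) (nclauses alpha N) (log_nsat mu n0) / n0%:R.

(** [sup Phi] is the limsup over n0 of the liminf over N of [x n0 N]. *)
Let Phi := [set c : R | forall n1, exists2 n0, (n1 <= n0)%N &
  exists N2, forall N, (N2 <= N)%N -> c <= x n0 N].

Let ln20 : 0 < ln 2 :> R. Proof. by rewrite ln_gt0// ltr1n. Qed.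

Let has_sup_Phi : has_sup Phi.
Proof.
split.
  exists 0 => n1; exists n1.+1; first exact: leqnSn.
  exists n1.+1 => N nN; rewrite divr_ge0//.
  rewrite -(binE_cst (n1.+1%:R / N%:R) (nclauses alpha N) 0).
  by apply: ler_binE => [|j]; [apply: frac01|apply: log_nsat_ge0].
exists (2%:R * ln 2) => c /(_ 1%N)[n0 n00 [N2 /(_ (maxn N2 n0))]].
rewrite leq_maxl => /(_ isT) /le_trans; apply.
have n0p : 1 <= n0%:R :> R by rewrite ler1n.
rewrite ler_pdivrMr ?ltr0n//.
apply: le_trans (_ : n0.+1%:R * ln 2 <= _); last by rewrite -[n0.+1%:R]natr1; have := ln20; nra.
rewrite -[leRHS](binE_cst (n0%:R / (maxn N2 n0)%:R) (nclauses alpha (maxn N2 n0))).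
apply: ler_binE => [|j]; last exact: log_nsat_le.
by apply: frac01; rewrite n00 leq_maxr.
Qed.

(** The block size n0 is fixed first. Raising the density by d then adds about d n0 clauses on
    average to a block, each lowering its value by at most [b], so d can be chosen in terms of
    n0. *)
Let lower (eta : R) : 0 < eta -> exists2 d : R, 0 < d <= a0 - alpha &
  exists N3, forall N, (N3 <= N)%N ->
    sup Phi - eta <= log_nsat mu N (nclauses (alpha + d) N) / N%:R.
Proof.
move=> eta0; have e3 : 0 < eta / 3%:R by rewrite divr_gt0.
have [c cPhi cs] := sup_adherent e3 has_sup_Phi.
have [N1 N1p hN1] := block e3.
have [n0 N1n0 [Na hNa]] := cPhi N1.
have n00 : (0 < n0)%N := leq_trans N1p N1n0.
have n0p : 0 < n0%:R :> R by rewrite ltr0n.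
have [Nb hNb] := hN1 n0 N1n0.
set b : R := n0.+1%:R * ln 2.
have b0 : 0 < b by rewrite mulr_gt0.
(* The first bound keeps the density below [a0]; the second makes d b <= eta / 6, the other eta / 6
   covering the clause gained by rounding. *)
pose d := Order.min (a0 - alpha) (eta / (6%:R * b)).
have d0 : 0 < d by rewrite lt_min subr_gt0 alpha_lt divr_gt0// mulr_gt0.
have da : d <= a0 - alpha by rewrite ge_min lexx.
have db : d * b <= eta / 6%:R.
  have : d <= eta / (6%:R * b) by rewrite ge_min lexx orbT.
  rewrite ler_pdivlMr ?mulr_gt0//; lra.
exists d; first by rewrite d0.
clearbody d.
exists (maxn (maxn Na Nb) (maxn n0 (Num.truncn (6%:R * b / eta)).+1)) => N.
rewrite !geq_max => /andP[/andP[NaN NbN] /andP[n0N KN]].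
have Np : 0 < N%:R :> R by rewrite ltr0n (leq_trans n00).
have bN : 6%:R * b <= N%:R * eta.
  rewrite -ler_pdivrMr//; apply: ltW; apply: lt_le_trans (truncnS_gt _) _.
  by rewrite ler_nat.
have ad0 : 0 <= alpha + d by rewrite addr_ge0// ltW.
have /andP[M1 M2] := nclausesP N alpha0.
have /andP[M1' M2'] := nclausesP N ad0.
have MM' : (nclauses alpha N <= nclauses (alpha + d) N)%N.
  by apply: le_truncn; rewrite ler_wpM2r// lerDl ltW.
have := hNb N (nclauses (alpha + d) N) NbN.
have -> : (nclauses (alpha + d) N)%:R <= a0 * N%:R.
  by apply: le_trans M1' _; rewrite ler_wpM2r//; lra.
move=> /(_ isT); apply: le_trans.
have p01 : 0 <= (n0%:R / N%:R : R) <= 1 by apply: frac01; rewrite n00.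
have fb j : log_nsat mu n0 j - b <= log_nsat mu n0 j.+1.
  have := log_nsat_le hmu j n00; have := log_nsat_ge0 hmu j.+1 n00.
  rewrite -/b; lra.
have := @binE_lipschitz R _ (nclauses alpha N)
  (nclauses (alpha + d) N - nclauses alpha N) (log_nsat mu n0) b p01 fb.
rewrite subnKC// natrB// => h.
have hc := hNa N NaN.
set B' := binE _ (nclauses (alpha + d) N) _ in h *.
have xB : x n0 N - eta / 3%:R <= B' / n0%:R.
  rewrite ler_pdivlMr// mulrBl /x divfK ?gt_eqF//; apply: le_trans h.
  rewrite lerD2l lerN2; set DD := _ - _.
  have DDN : DD <= d * N%:R + 1 by rewrite /DD; lra.
  have -> : DD * (n0%:R / N%:R * b) = DD * b / N%:R * n0%:R by ring.
  rewrite ler_wpM2r// ler_pdivrMr//.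
  apply: le_trans (ler_wpM2r (ltW b0) DDN) _.
  have := ler_wpM2r (ltW Np) db; lra.
have := lerD hc xB; lra.
Qed.

Let upper (eta : R) : 0 < eta -> exists N3, forall n, (N3 <= n)%N ->
  log_nsat mu n (nclauses alpha n) / n%:R <= sup Phi + eta.
Proof.
move=> eta0; apply: contrapT => /forallNP hN.
have eta'0 : 0 < eta / 64%:R by rewrite divr_gt0.
have [d /andP[d0 da] [N3 hN3]] := lower eta'0.
(* The average keeps 1/16 of the excess eta and loses 15/16 of eta / 64 from [lower] and eta / 64
   from the tail, which leaves 33 eta / 1024 > eta / 32. *)
suff : Phi (sup Phi + eta / 32%:R).
  by move=> /(sup_upper_bound has_sup_Phi); lra.
move=> n1.
pose K1 := (Num.truncn (3%:R / alpha)).+1.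
pose K2 := (Num.truncn (2%:R * ln 2 * (alpha / d ^+ 2) / (eta / 64%:R))).+1.
have /existsNP[n0 /not_implyP[n0n /negP]] := hN (maxn (maxn n1 N3) (maxn K1 K2)).
rewrite -ltNge => Ahi.
move: n0n; rewrite !geq_max => /andP[/andP[n1n0 N3n0] /andP[K1n K2n]].
exists n0 => //; exists (2 * n0)%N => N nN.
have n00 : (0 < n0)%N by rewrite (leq_trans _ K1n).
have n0p : 0 < n0%:R :> R by rewrite ltr0n.
have n01 : 1 <= n0%:R :> R by rewrite ler1n.
have Np : 0 < N%:R :> R by rewrite ltr0n; lia.
have Blo := hN3 n0 N3n0.
have ad0 : 0 <= alpha + d by rewrite addr_ge0// ltW.
set GA := log_nsat mu n0 (nclauses alpha n0) in Ahi.
set GB := log_nsat mu n0 (nclauses (alpha + d) n0) in Blo.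
have GB0 : 0 <= GB by exact: log_nsat_ge0.
have GBu : GB <= 2%:R * n0%:R * ln 2.
  by apply: le_trans (log_nsat_le hmu _ n00) _; rewrite -[n0.+1%:R]natr1; have := ln20; nra.
have GAB : GB <= GA.
  apply: log_nsat_antitone => //; apply: le_truncn.
  by rewrite ler_wpM2r// lerDl ltW.
have cases : alpha = 0 \/ 3%:R <= alpha * n0%:R.
  have [|an0] := eqVneq alpha 0; [by left|right].
  have ap : 0 < alpha by rewrite lt_neqAle eq_sym an0.
  rewrite [leRHS]mulrC -ler_pdivrMr//; apply: ltW; apply: lt_le_trans (truncnS_gt _) _.
  by rewrite ler_nat.
have tail : 2%:R * ln 2 * (alpha / d ^+ 2) <= eta / 64%:R * n0%:R.
  rewrite [leRHS]mulrC -ler_pdivrMr//; apply: ltW; apply: lt_le_trans (truncnS_gt _) _.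
  by rewrite ler_nat.
have med := binE_nclauses_le_mean alpha0 n00 nN cases.
have p01 : 0 <= (n0%:R / N%:R : R) <= 1 by apply: frac01; rewrite n00 (leq_trans _ nN)// leq_pmull.
set p : R := n0%:R / N%:R in p01 med.
have /andP[M1 _] := nclausesP N alpha0; set M := nclauses alpha N in M1 med.
have pM : p * M%:R <= alpha * n0%:R.
  have -> : alpha * n0%:R = p * (alpha * N%:R) by rewrite /p; field; rewrite gt_eqF.
  by rewrite ler_wpM2l//; case/andP: p01.
have pMt : p * M%:R < (alpha + d) * n0%:R.
  by apply: le_lt_trans pM _; rewrite ltr_pM2r// ltrDl.
have cheb : binE p M (fun j => ((alpha + d) * n0%:R < j%:R)%R%:R)
    <= alpha / (d ^+ 2 * n0%:R).
  apply: le_trans (binE_chebyshev p01 pMt) _.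
  have dn : 0 < d * n0%:R by rewrite mulr_gt0.
  have -> : alpha / (d ^+ 2 * n0%:R) = alpha * n0%:R / (d * n0%:R) ^+ 2.
    by field; rewrite !gt_eqF.
  apply: ler_pM => //.
  - by rewrite mulr_ge0//; case/andP: p01.
  - by rewrite invr_ge0 sqr_ge0.
  rewrite lef_pV2 ?posrE ?exprn_gt0//; last by rewrite subr_gt0.
  rewrite ler_sqr ?nnegrE ?(ltW dn)//; first by lra.
  by rewrite subr_ge0 ltW.
(* By monotonicity the value is at least [GA] up to alpha n0 clauses and at least [GB] up to (alpha
   + d) n0; beyond that it is only nonnegative. *)
have low : GB + (GA - GB) * binE p M (fun j => (j%:R <= alpha * n0%:R)%R%:R)
    + - GB * binE p M (fun j => ((alpha + d) * n0%:R < j%:R)%R%:R)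
    <= binE p M (log_nsat mu n0).
  rewrite -{1}(binE_cst p M GB) -!binEZ -!binED; apply: ler_binE => // j.
  have gj := log_nsat_ge0 hmu j n00.
  have [ja|aj] := lerP j%:R (alpha * n0%:R).
    have -> : ((alpha + d) * n0%:R < j%:R) = false.
      by apply/negbTE; rewrite -leNgt (le_trans ja)// ler_wpM2r// lerDl ltW.
    rewrite mulr1 mulr0 addr0 addrC subrK; apply: log_nsat_antitone => //.
    by rewrite truncn_ge_nat// mulr_ge0.
  have [jb|bj] := ltP ((alpha + d) * n0%:R) j%:R; rewrite !mulr0 addr0.
    by rewrite mulr1 subrr.
  rewrite addr0; apply: log_nsat_antitone => //.
  by rewrite truncn_ge_nat// mulr_ge0.
rewrite /x -/p -/M ler_pdivlMr//; apply: le_trans low.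
rewrite ltr_pdivlMr// in Ahi; rewrite ler_pdivlMr// in Blo.
have e1 : (GA - GB) / 16%:R <=
  (GA - GB) * binE p M (fun j => (j%:R <= alpha * n0%:R)%R%:R).
  by rewrite ler_wpM2l// subr_ge0.
have e2 : GB * binE p M (fun j => ((alpha + d) * n0%:R < j%:R)%R%:R)
    <= eta / 64%:R * n0%:R.
  apply: le_trans (ler_wpM2l GB0 cheb) _.
  apply: le_trans (ler_wpM2r _ GBu) _.
    by rewrite divr_ge0// mulr_ge0 ?sqr_ge0.
  apply: le_trans tail; rewrite le_eqVlt; apply/orP; left; apply/eqP.
  by field; rewrite !gt_eqF.
rewrite mulNr; lra.
Qed.

Lemma cvg_log_nsat :
  log_nsat mu n (nclauses alpha n) / n%:R @[n --> \oo] --> sup Phi.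
Proof.
apply/cvgrPdist_le => eta eta0.
have [d /andP[d0 _] [Na hNa]] := lower eta0; have [Nb hNb] := upper eta0.
exists (maxn 1 (maxn Na Nb)) => // n /=; rewrite !geq_max => /and3P[n0 an bn].
have := hNb n bn; have := hNa n an.
have : log_nsat mu n (nclauses (alpha + d) n) / n%:R <=
    log_nsat mu n (nclauses alpha n) / n%:R.
  rewrite ler_wpM2r ?invr_ge0//; apply: log_nsat_antitone => //.
  by apply: le_truncn; rewrite ler_wpM2r// lerDl ltW.
rewrite ler_norml; move=> h1 h2 h3; apply/andP; split; lra.
Qed.

End Limit.

(** * Back to ln Z conditioned on satisfiability *)

Section Conditioning.
Context {R : realType} {k : nat} (mu : {ffun boolfun k -> R}).
Hypothesis hmu : is_pmf mu.

Lemma expect_formula (alpha : R) n (f : nat -> R) :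
  \sum_F formula_pmf mu alpha n F * f (nsat F) =
  iter (nclauses alpha n) (step mu id)
    (fun S : {set cube 'I_n} => f #|S|) [set: cube 'I_n]%SET.
Proof.
rewrite -sum_formula; apply: eq_bigr => F _; rewrite ffunE; congr (_ * f _).
by rewrite finset.setTI; apply: eq_card => x; apply/idP/idP; rewrite !inE.
Qed.

Lemma prob_unsatE (alpha : R) n :
  prob_unsat mu alpha n = unsat mu n (nclauses alpha n).
Proof.
rewrite /unsat -[RHS](expect_formula alpha n (fun z => (z == 0)%N%:R)).
rewrite /prob_unsat /prob big_mkcond /=; apply: eq_bigr => F _.
by case: (_ == _); rewrite ?mulr1 ?mulr0.
Qed.

Lemma prob_sat (alpha : R) n : (0 < n)%N ->
  prob (formula_pmf mu alpha n) (fun F => 1 <= nsat F)%N =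
  1 - unsat mu n (nclauses alpha n).
Proof.
move=> n0; rewrite -prob_unsatE.
have h1 : \sum_F formula_pmf mu alpha n F = 1.
  rewrite -[RHS](iter_step_cst hmu (id : 'I_n -> _) n0 (nclauses alpha n) 1 [set: _]%SET).
  rewrite -(expect_formula alpha n (fun=> 1)).
  by apply: eq_bigr => F _; rewrite mulr1.
rewrite -h1 (bigID (fun F => nsat F == 0)%N) /= /prob_unsat /prob addrAC subrr add0r.
by apply: eq_bigl => F; rewrite lt0n.
Qed.

(** [h] is the mean of ln Z divided by n, with ln 0 = 0, so unsatisfiable formulas contribute
    nothing and conditioning is only a division by 1 - u; moreover ln (1 + z) and ln z differ by at
    most ln 2. *)
Lemma psi_bounds (alpha : R) n : (0 < n)%N ->
  let g := log_nsat mu n (nclauses alpha n) / n%:R in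
  let u := unsat mu n (nclauses alpha n) in
  exists2 h, psi mu alpha n = h / (1 - u) & g - ln 2 / n%:R <= h <= g.
Proof.
move=> n0 g u; have nR : 0 < n%:R :> R by rewrite ltr0n.
pose E := \sum_F formula_pmf mu alpha n F * ln (nsat F)%:R.
have EE : E = iter (nclauses alpha n) (step mu id)
    (fun S : {set cube 'I_n} => ln #|S|%:R) [set: cube 'I_n]%SET.
  exact: (expect_formula alpha n (fun z => ln z%:R)).
exists (E / n%:R).
  rewrite /psi /cond_expect prob_sat// -/u.
  have -> : \sum_(F | (1 <= nsat F)%N) formula_pmf mu alpha n F * ln (nsat F)%:R = E.
    rewrite /E [RHS](bigID (fun F => 1 <= nsat F)%N) /= [X in _ = _ + X]big1 ?addr0//.
    move=> F; rewrite -leqNgt leqn0 => /eqP ->.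
    by rewrite ln0 ?mulr0.
  by rewrite mulrA [_^-1 * E]mulrC.
have ln2_ge0 : 0 <= ln 2 :> R by rewrite ln_ge0// ler1n.
have lnz (z : nat) : ln (1 + z%:R) - ln 2 <= (ln z%:R : R) <= ln (1 + z%:R).
  have [->|z0] := posnP z; first by rewrite mulr0n addr0 ln1 (ln0 (lexx _)) sub0r oppr_le0 ln2_ge0 lexx.
  have z1 : 1 <= z%:R :> R by rewrite ler1n.
  have zp : 0 < z%:R :> R by lra.
  rewrite lerBlDr -lnM ?posrE// !ler_ln ?posrE; [|lra..].
  by apply/andP; split; lra.
rewrite /g -mulrBl !ler_pM2r ?invr_gt0// EE; apply/andP; split; last first.
  by apply: ler_iter_step => // S; have /andP[] := lnz #|S|.
rewrite /log_nsat.
rewrite -[ln 2](iter_step_cst hmu (id : 'I_n -> _) n0 (nclauses alpha n) (ln 2) [set: _]%SET).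
rewrite -[X in X - _]mul1r -mulN1r -iter_stepD.
apply: ler_iter_step => // S; have /andP[+ _] := lnz #|S|.
by rewrite /lnp1; lra.
Qed.

End Conditioning.

Lemma cvg_polylog (R : realType) (C eps : R) : 0 < C -> 0 < eps ->
  C * (ln n%:R `^ (1 + eps))^-1 @[n --> \oo] --> (0 : R).
Proof.
move=> C0 eps0; apply/cvgrPdist_le => d d0.
pose K := Num.max 1 (C / d).
exists (Num.truncn (expR K)).+1 => // n /= Kn.
have nK : expR K <= n%:R.
  by apply: ltW; apply: lt_le_trans (truncnS_gt _) _; rewrite ler_nat.
have np : 0 < n%:R :> R by apply: lt_le_trans nK; exact: expR_gt0.
have lK : K <= ln n%:R by rewrite -ler_expR lnK ?posrE.
have l1 : 1 <= ln n%:R :> R by apply: le_trans lK; rewrite le_max lexx.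
have lC : C / d <= ln n%:R by apply: le_trans lK; rewrite le_max lexx orbT.
have lp : ln n%:R <= ln n%:R `^ (1 + eps) :> R.
  by apply: le1r_powR => //; rewrite lerDl ltW.
have pp : 0 < ln n%:R `^ (1 + eps) :> R by apply: lt_le_trans lp; lra.
rewrite sub0r normrN ger0_norm ?divr_ge0 ?(ltW C0) ?(ltW pp)// ler_pdivrMr//.
rewrite [leRHS]mulrC -ler_pdivrMr//; exact: le_trans lp.
Qed.

Theorem theorem6 (R : realType) (k : nat) (hk : (1 <= k)%N)
    (mu : {ffun boolfun k -> R}) (hmu : is_pmf mu)
    (hGamma : forall l : nat, (1 <= l)%N -> Gamma_convex mu l) :
  forall alpha : R, 0 <= alpha -> (alpha%:E < alpha_star mu)%E ->
    exists phi_s : R, psi mu alpha @ \oo --> phi_s.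
Proof.
move=> alpha alpha0 /ereal_sup_gt[_ [a1 [a10 [eps eps0 /eqO_exP hO]] <-]].
rewrite lte_fin => a1_gt; have [C C0 [T _ hT]] := hO.
have decay n : (T <= n)%N -> unsat mu n (Num.truncn (a1 * n%:R)) <=
    C * (ln n%:R `^ (1 + eps))^-1.
  move=> /hT /=; rewrite prob_unsatE [X in _ <= _ * X]ger0_norm ?invr_ge0 ?powR_ge0//.
  exact: le_trans (ler_norm _).
(* The midpoint leaves a margin on both sides: above, for the fluctuations of the number of clauses
   in a block; below, for raising the density alpha. *)
pose a0 := (alpha + a1) / 2.
have a00 : 0 <= a0 by rewrite /a0; lra.
have a01 : a0 < a1 by rewrite /a0; lra.
have aa0 : alpha < a0 by rewrite /a0; lra.
have [phi gphi] : exists phi : R,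
    log_nsat mu n (nclauses alpha n) / n%:R @[n --> \oo] --> phi.
  eexists; apply: (cvg_log_nsat hmu alpha0 aa0) => delta delta0.
  exact: (log_nsat_block hmu hGamma a00 a01 eps0 (ltW C0) decay).
exists phi.
have u0 : unsat mu n (nclauses alpha n) @[n --> \oo] --> (0 : R).
  apply: (@squeeze_cvgr _ _ _ _ (fun=> 0)
    (fun n => C * (ln n%:R `^ (1 + eps))^-1)); last exact: cvg_polylog.
    exists (maxn 1 T) => // n /=; rewrite geq_max => /andP[n0 Tn].
    rewrite unsat_ge0//=; apply: le_trans (decay n Tn).
    by apply: unsat_monotone => //; apply: le_truncn; rewrite ler_wpM2r// ltW.
  exact: cvg_cst.
have v1 : (1 - unsat mu n (nclauses alpha n))^-1 @[n --> \oo] --> (1 : R).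
  rewrite -[X in _ --> X]invr1; apply: cvgV; first exact: oner_neq0.
  rewrite -[X in _ --> X](subr0 1); apply: cvgB; [exact: cvg_cst | exact: u0].
have l0 : ln 2 / n%:R @[n --> \oo] --> (0 : R).
  rewrite -[X in _ --> X](mulr0 (ln 2)); apply: cvgM; first exact: cvg_cst.
  by rewrite -cvg_shiftS; exact: cvg_harmonic.
apply: (@squeeze_cvgr _ _ _ _
  (fun n => (log_nsat mu n (nclauses alpha n) / n%:R - ln 2 / n%:R) *
    (1 - unsat mu n (nclauses alpha n))^-1)
  (fun n => log_nsat mu n (nclauses alpha n) / n%:R *
    (1 - unsat mu n (nclauses alpha n))^-1)).
- exists 1%N => // n /= n0; have [h -> /andP[h1 h2]] := psi_bounds hmu alpha n0.
  have u1 : 0 <= (1 - unsat mu n (nclauses alpha n))^-1.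
    by rewrite invr_ge0 subr_ge0 unsat_le1.
  by rewrite !ler_wpM2r.
- rewrite -[X in _ --> X](mulr1 phi); apply: cvgM; last exact: v1.
  by rewrite -[X in _ --> X](subr0 phi); apply: cvgB; [exact: gphi | exact: l0].
- by rewrite -[X in _ --> X](mulr1 phi); apply: cvgM; [exact: gphi | exact: v1].
Qed.
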